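(* Let $E$ be a Banach space and $1\le p\le\infty$. There exists a pair $\bigl(\mathrm{FBL}^{(p)}[E],\phi_E\bigr)$, where $\mathrm{FBL}^{(p)}[E]$ is a $p$-convex Banach lattice with $p$-convexity constant $1$ and $\phi_E\colon E\to \mathrm{FBL}^{(p)}[E]$ is a linear isometry, with the following universal property: for every $p$-convex Banach lattice $X$ and every bounded linear operator $T\colon E\to X$, there exists a unique linear lattice homomorphism $\widehat{T}\colon \mathrm{FBL}^{(p)}[E]\to X$ such that $\widehat{T}\circ\phi_E=T$. Moreover, $\|\widehat{T}\|\le M^{(p)}(X)\,\|T\|$, where $M^{(p)}(X)$ denotes the $p$-convexity constant of $X$, and the pair $\bigl(\mathrm{FBL}^{(p)}[E],\phi_E\bigr)$ is essentially unique.
   Context: All vector spaces, Banach spaces and Banach lattices are real. Linear isometries are not assumed surjective. A Banach lattice $X$ is $p$-convex ($p\in[1,\infty]$) if there is a constant $M\ge1$ such that for every $m\in\mathbb N$ and $x_1,\dots,x_m\in X$, $$\Bigl\|\Bigl(\sum_{k=1}^m|x_k|^p\Bigr)^{1/p}\Bigr\|\le M\Bigl(\sum_{k=1}^m\|x_k\|^p\Bigr)^{1/p},$$ where the expression on the left is defined by the positively homogeneous continuous function calculus of Banach lattices, and for $p=\infty$ the expressions are interpreted as $\bigvee_k|x_k|$ and $\max_k\|x_k\|$. The least such $M$ is the $p$-convexity constant $M^{(p)}(X)$. ''Essentially unique'' means: if $(F,\phi)$ is another pair with all the stated properties (including the norm bound), then there is an isometric lattice isomorphism $U\colon \mathrm{FBL}^{(p)}[E]\to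 F$ with $U\circ\phi_E=\phi$. *)

(* Defs.v *)
From HB Require Import structures.
From mathcomp Require Import all_boot all_order all_algebra.
From mathcomp Require Import all_classical all_reals all_analysis.

Set Implicit Arguments.
Unset Strict Implicit.
Unset Printing Implicit Defensive.

Import Order.TTheory GRing.Theory Num.Theory.
Import numFieldNormedType.Exports.

Local Open Scope classical_set_scope.
Local Open Scope ring_scope.

(* The order is given by fields of its own: MathComp has no common ancestor of
   its additive structures and its lattices from which [Num.RealDomain]
   inherits, so the hierarchy cannot be extended with a structure inheriting
   from both.  The [Order.Lattice] structure is recovered below. *)
HB.mixin Record CompleteNormedModule_isBanachLattice (R : realType) X
    of CompleteNormedModule R X := {
  bl_le : rel X;
  bl_meet : X -> X -> X;
  bl_join : X -> X -> X;
  bl_le_refl : reflexive bl_le;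
  bl_le_anti : antisymmetric bl_le;
  bl_le_trans : transitive bl_le;
  bl_meetP : forall x y z, bl_le x (bl_meet y z) = bl_le x y && bl_le x z;
  bl_joinP : forall x y z, bl_le (bl_join x y) z = bl_le x z && bl_le y z;
  bl_leD2l : forall x y z, bl_le x y -> bl_le (z + x) (z + y);
  bl_scale_ge0 : forall (a : R) x, 0 <= a -> bl_le 0 x -> bl_le 0 (a *: x);
  bl_le_norm : forall x y,
    bl_le (bl_join x (- x)) (bl_join y (- y)) -> `|x| <= `|y|
}.

#[short(type="banachLatticeType")]
HB.structure Definition BanachLattice (R : realType) :=
  { X of CompleteNormedModule R X & CompleteNormedModule_isBanachLattice R X }.

HB.instance Definition _ (R : realType) (X : banachLatticeType R) :=
  Order.Le_isPOrder.Build ring_display (BanachLattice.sort X)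
    (@bl_le_refl R X) (@bl_le_anti R X) (@bl_le_trans R X).
HB.instance Definition _ (R : realType) (X : banachLatticeType R) :=
  Order.POrder_MeetJoin_isLattice.Build ring_display (BanachLattice.sort X)
    (@bl_meetP R X) (@bl_joinP R X).

(* [`|x|] is the norm of [x], [modulus x] its lattice absolute value. *)
Definition modulus (R : realType) (X : banachLatticeType R) (x : X) : X :=
  Order.join x (- x).

Definition lattice_hom (R : realType) (X Y : banachLatticeType R)
    (f : X -> Y) : Prop :=
  Order.meet_morphism f /\ Order.join_morphism f.

Definition opnorm (R : realType) (V W : normedModType R) (T : V -> W) : \bar R :=
  ereal_sup [set (`|T x|)%:E | x in [set x : V | `|x| <= 1]].

Definition poshom_continuous (R : realType) (m : nat) (h : 'rV[R]_m -> R) :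
    Prop :=
  continuous h /\ (forall (t : R) (s : 'rV[R]_m), 0 <= t -> h (t *: s) = t * h s).

(* [Phi] is only constrained on the continuous positively homogeneous functions:
   there it is the linear lattice homomorphism sending the [k]-th coordinate
   function to [x k]. *)
Definition is_functional_calculus (R : realType) (X : banachLatticeType R)
    (m : nat) (x : 'I_m -> X) (Phi : ('rV[R]_m -> R) -> X) : Prop :=
  [/\ forall (a : R) h1 h2, poshom_continuous h1 -> poshom_continuous h2 ->
        Phi (fun s => a * h1 s + h2 s) = a *: Phi h1 + Phi h2,
      forall h1 h2, poshom_continuous h1 -> poshom_continuous h2 ->
        Phi (fun s => Num.min (h1 s) (h2 s)) = Order.meet (Phi h1) (Phi h2),
      forall h1 h2, poshom_continuous h1 -> poshom_continuous h2 ->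
        Phi (fun s => Num.max (h1 s) (h2 s)) = Order.join (Phi h1) (Phi h2)
    & forall k, Phi (fun s => s ord0 k) = x k].

(* [h (x_1, ..., x_m)].  In a Banach lattice the functional calculus at [x]
   exists and is unique on positively homogeneous continuous functions, so the
   default value [0] is never used for such [h]. *)
Definition functional_calculus (R : realType) (X : banachLatticeType R)
    (m : nat) (x : 'I_m -> X) (h : 'rV[R]_m -> R) : X :=
  xget 0 [set y | exists2 Phi, is_functional_calculus x Phi & y = Phi h].

(* The case [p = -oo] is excluded wherever this is used. *)
Definition convex_with (R : realType) (p : \bar R) (X : banachLatticeType R)
    (M : R) : Prop :=
  match p with
  | r%:E => forall (m : nat) (x : 'I_m -> X),
      `|functional_calculus x
          (fun s => (\sum_(k < m) `|s ord0 k| `^ r) `^ r^-1)|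
        <= M * (\sum_(k < m) `|x k| `^ r) `^ r^-1
  | +oo%E => forall (m : nat) (x : 'I_m -> X),
      `|\big[Order.join/0]_(k < m) modulus (x k)|
        <= M * \big[Num.max/0]_(k < m) `|x k|
  | -oo%E => False
  end.

Definition convexity_constants (R : realType) (p : \bar R)
    (X : banachLatticeType R) : set R :=
  [set M | 1 <= M /\ convex_with p X M].

Definition p_convex (R : realType) (p : \bar R) (X : banachLatticeType R) :
    Prop :=
  exists M, convexity_constants p X M.

Definition convexity_constant (R : realType) (p : \bar R)
    (X : banachLatticeType R) : R :=
  inf (convexity_constants p X).

Definition is_free_banach_lattice (R : realType) (p : \bar R)
    (E : completeNormedModType R) (F : banachLatticeType R)
    (phi : {linear E -> F}) : Prop :=
  [/\ p_convex p F,
      convexity_constant p F = 1,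
      (forall x, `|phi x| = `|x|)
    & forall (X : banachLatticeType R) (T : {linear E -> X}),
        p_convex p X -> (opnorm T < +oo)%E ->
        exists That : {linear F -> X},
          [/\ lattice_hom That,
              That \o phi =1 T,
              (opnorm That <= (convexity_constant p X)%:E * opnorm T)%E
            & forall S : {linear F -> X},
                lattice_hom S -> S \o phi =1 T -> S =1 That]].

(* Main.v *)
From HB Require Import structures.
From mathcomp Require Import all_boot all_order all_algebra.
From mathcomp Require Import all_classical all_reals all_analysis.
From mathcomp Require Import generic_quotient ring_quotient ring lra.
Require Import Defs.

Set Implicit Arguments.
Unset Strict Implicit.
Unset Printing Implicit Defensive.

Import Order.TTheory GRing.Theory Num.Theory.
Import numFieldNormedType.Exports.

Local Open Scope classical_set_scope.
Local Open Scope ring_scope.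
Local Open Scope quotient_scope.

(** Write [N] for the finite l^p norm and [delta_x] for the evaluation at [x], a
    function on the unit ball of the dual of [E].  The vector lattice [L] of
    functions generated by the [delta_x] carries the norm
      [nu f = inf { N(|x_1|, ..., |x_n|) : |f| <= N(delta_x_1, ..., delta_x_n) }],
    the largest one compatible with p-convexity with constant 1 and with
    [nu delta_x <= |x|].  The free lattice is the completion of [(L, nu)].

    That [nu] is a norm, p-convex with constant 1, is elementary
    ([dominated_conv], [free_norm_pnorm]): dominating families are scaled and
    concatenated.  That [nu delta_x = |x|] is the Hahn--Banach theorem.

    For the universal property, let [T : E -> X] be bounded.  A lattice expression
    [t] in vectors of [E] is sent to the same expression in their images.  This
    is well defined and monotone ([leval_ge0]): in normal form, [t] is a difference
    of finite joins, so that [t >= 0] reduces to inequalities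
    [0 <= v_1 \/ ... \/ v_k].  If this holds at all functionals, then by separation
    the convex hull of the [v_i] comes arbitrarily close to [0]; as
    [T v_1 \/ ... \/ T v_k] dominates the images of the convex combinations, it is
    nonnegative.  If moreover [|t| <= N(delta_x)], the same comparison in [X],
    applied to lattice expressions that approximate [N], gives
    [|t(T)| <= N(T x_1, ..., T x_n)] in the functional calculus of [X], so that
    [|t(T)| <= M |T| nu t] when [X] is p-convex with constant [M]
    ([leval_free_norm]).  Hence the extension is continuous and passes to the
    completion; it is unique because lattice homomorphisms between Banach lattices
    are automatically continuous ([lattice_hom_bounded]).

    The functional calculus itself is obtained from the same positivity result with
    [E] replaced by a finite-dimensional space, together with the density of lattice
    expressions among positively homogeneous continuous functions
    ([lfun_dense]).  Both extensions by density are instances of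
    [dense_extension]. *)

(** * Order and norm in Banach lattices *)

Section BanachLatticeTheory.
Context (R : realType) (X : banachLatticeType R).
Implicit Types x y z t : X.

Lemma blD2l z x y : (z + x <= z + y) = (x <= y).
Proof.
apply/idP/idP => [h|]; last exact: bl_leD2l.
have := bl_leD2l _ _ (- z) h; rewrite !addKr; exact.
Qed.

Lemma blD2r z x y : (x + z <= y + z) = (x <= y).
Proof. by rewrite ![_ + z]addrC blD2l. Qed.

Lemma blD x y z t : x <= y -> z <= t -> x + z <= y + t.
Proof. by move=> xy zt; apply: (@le_trans _ _ (y + z)); rewrite ?blD2r ?blD2l. Qed.

Lemma bl_subr_ge0 x y : (0 <= x - y) = (y <= x).
Proof. by rewrite -(blD2r y 0) add0r subrK. Qed.

Lemma blN2 x y : (- x <= - y) = (y <= x).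
Proof. by rewrite -(blD2l x (- x)) subrr bl_subr_ge0. Qed.

Lemma blBlDr x y z : (x - y <= z) = (x <= z + y).
Proof. by rewrite -(blD2r y (x - y)) subrK. Qed.

Lemma blBrDl x y z : (x <= - z + y) = (z + x <= y).
Proof. by rewrite -(blD2l z x) addNKr. Qed.

Lemma blZ (a : R) x y : 0 <= a -> x <= y -> a *: x <= a *: y.
Proof.
move=> a0; rewrite -bl_subr_ge0 -[a *: x <= _]bl_subr_ge0 -scalerBr.
exact: bl_scale_ge0.
Qed.

Lemma blZP (a : R) x y : 0 < a -> (a *: x <= a *: y) = (x <= y).
Proof.
move=> a0; apply/idP/idP => [|h]; last by apply: blZ => //; exact: ltW.
move=> h; have := blZ (ltW (divr_gt0 ltr01 a0)) h.
by rewrite !scalerA mul1r mulVf ?gt_eqF// !scale1r.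
Qed.

Lemma bl_joinDr z x y : z + Order.join x y = Order.join (z + x) (z + y).
Proof.
apply/le_anti/andP; split; last by rewrite leUx !blD2l leUl leUr.
by rewrite -blBrDl leUx !blBrDl leUl leUr.
Qed.

Lemma bl_joinZ (a : R) x y : 0 <= a ->
  a *: Order.join x y = Order.join (a *: x) (a *: y).
Proof.
rewrite le_eqVlt => /orP[/eqP<-|a0]; first by rewrite !scale0r joinxx.
apply/le_anti/andP; split; last by rewrite leUx !blZP// leUl leUr.
have a1 : 0 < a^-1 by rewrite invr_gt0.
rewrite -(blZP (a *: _) _ a1) scalerA mulVf ?gt_eqF// scale1r.
by rewrite leUx -(blZP x _ a0) -(blZP y _ a0) scalerA mulfV ?gt_eqF// scale1r leUl leUr.
Qed.

Lemma bl_meetE x y : Order.meet x y = - Order.join (- x) (- y).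
Proof.
apply/le_anti/andP; split.
  by rewrite -blN2 opprK leUx !blN2 leIl leIr.
by rewrite lexI -[_ <= x]blN2 -[_ <= y]blN2 !opprK leUl leUr.
Qed.

Lemma modulus_le x y : (modulus x <= y) = (x <= y) && (- x <= y).
Proof. exact: leUx. Qed.

Lemma le_modulus x : x <= modulus x. Proof. exact: leUl. Qed.
Lemma leN_modulus x : - x <= modulus x. Proof. exact: leUr. Qed.

Lemma modulus_ge0 x : 0 <= modulus x.
Proof.
have h : 0 <= (2 : R) *: modulus x.
  by rewrite scaler_nat mulr2n -(subrr x) blD ?le_modulus ?leN_modulus.
by rewrite -(@blZP 2)// scaler0.
Qed.

Lemma modulus_id x : 0 <= x -> modulus x = x.
Proof.
move=> x0; apply/le_anti; rewrite le_modulus modulus_le lexx/= andbT.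
by apply: (le_trans _ x0); rewrite -[leRHS]oppr0 blN2.
Qed.

Lemma modulusN x : modulus (- x) = modulus x.
Proof. by rewrite /modulus opprK joinC. Qed.

Lemma norm_modulus x : `|modulus x| = `|x|.
Proof.
have e : bl_join (modulus x) (- modulus x) = modulus x.
  exact: modulus_id (modulus_ge0 x).
by apply/le_anti/andP; split; apply: bl_le_norm; rewrite e; exact: lexx.
Qed.

Lemma le_norm_modulus x y : modulus x <= y -> `|x| <= `|y|.
Proof.
move=> h; apply: bl_le_norm.
rewrite [X in bl_le _ X](_ : _ = y)//; apply: modulus_id.
exact: le_trans (modulus_ge0 x) h.
Qed.

Lemma bl_ge0_norm x y : 0 <= x -> x <= y -> `|x| <= `|y|.
Proof. by move=> x0 xy; apply: le_norm_modulus; rewrite modulus_id. Qed.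

(** The join is nonexpansive because [x <= x' + |x - x'|] and the join is
    translation invariant. *)
Lemma modulus_joinB x y x' y' :
  modulus (Order.join x y - Order.join x' y')
    <= modulus (x - x') + modulus (y - y').
Proof.
have aux (u v u' v' : X) :
    Order.join u v - Order.join u' v' <= modulus (u - u') + modulus (v - v').
  rewrite blBlDr leUx bl_joinDr; apply/andP; split.
    apply: le_trans (leUl _ _); rewrite -[leLHS](subrK u') blD2r.
    by rewrite -[leLHS]addr0 blD ?le_modulus ?modulus_ge0.
  apply: le_trans (leUr _ _); rewrite -[leLHS](subrK v') blD2r.
  by rewrite -[leLHS]add0r blD ?le_modulus ?modulus_ge0.
rewrite modulus_le aux/= opprB.
by apply: le_trans (aux _ _ _ _) _; rewrite -modulusN opprB -(modulusN (y - _)) opprB.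
Qed.

Lemma norm_joinB x y x' y' :
  `|Order.join x y - Order.join x' y'| <= `|x - x'| + `|y - y'|.
Proof.
apply: le_trans (le_norm_modulus (modulus_joinB _ _ _ _)) _.
by apply: le_trans (ler_normD _ _) _; rewrite !norm_modulus.
Qed.

(** Closedness of the positive cone: [z] bounds the positive part of [x - y]. *)
Lemma bl_le_closed x y :
  (forall e : R, 0 < e -> exists2 z, x <= y + z & `|z| <= e) -> x <= y.
Proof.
move=> h; set w := Order.join (x - y) 0.
have w0 : 0 <= w by rewrite leUr.
suff : w = 0 by move=> w00; rewrite -(blD2r (- y)) subrr -w00 leUl.
apply/eqP; rewrite -normr_le0; apply/ler_addgt0Pr => e e0; rewrite add0r.
have [z xyz ze] := h _ e0; apply: le_trans ze.
rewrite -(norm_modulus z); apply: bl_ge0_norm => //.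
rewrite leUx modulus_ge0 andbT; apply: le_trans (le_modulus _).
by rewrite blBlDr addrC.
Qed.

End BanachLatticeTheory.

(** * The Hahn--Banach theorem *)

Section HahnBanach.
Context (R : realType) (V : lmodType R).
Implicit Types (p q : V -> R) (u v : V) (K : set (V * R)).

Definition sublinear p :=
  (forall u v, p (u + v) <= p u + p v) /\
  (forall (a : R) u, 0 <= a -> p (a *: u) <= a * p u).

Lemma sublinear0 p : sublinear p -> p 0 = 0.
Proof.
move=> [pD pZ]; apply/le_anti/andP; split.
  by have := pZ 0 0 (lexx _); rewrite scale0r mul0r.
by have := pD 0 0; rewrite addr0 -subr_ge0 addrK.
Qed.

Lemma sublinear_geN p u v : sublinear p -> p v - p (- u) <= p (u + v).
Proof.
by move=> [pD _]; rewrite lerBlDr -[leLHS]/(p v) -{1}(addKr u v) addrC pD.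
Qed.

(** Lowering a sublinear functional along a convex cone of constraints: a pair
    [(x, s)] of the cone asks for a functional that is at least [s] at [x]. *)
Definition lower p K v : R := inf [set p (v + x.1) - x.2 | x in K].

Definition convex_cone K :=
  [/\ K (0, 0), (forall x y, K x -> K y -> K (x.1 + y.1, x.2 + y.2)) &
      (forall (a : R) x, 0 <= a -> K x -> K (a *: x.1, a * x.2))].

Section Lower.
Variables (p : V -> R) (K : set (V * R)).
Hypotheses (p_sub : sublinear p) (K_cone : convex_cone K)
  (Kp : forall x, K x -> x.2 <= p x.1).

Lemma lower_le v x : K x -> lower p K v <= p (v + x.1) - x.2.
Proof.
move=> Kx; apply: ge_inf; last by exists x.
exists (- p (- v)) => _ [y Ky <-].
rewrite lerBrDr addrC; apply: le_trans (sublinear_geN _ _ p_sub).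
by rewrite lerD2r Kp.
Qed.

Lemma le_lower v b : (forall x, K x -> b <= p (v + x.1) - x.2) ->
  b <= lower p K v.
Proof.
move=> h; apply: lb_le_inf; last by move=> _ [x Kx <-]; exact: h.
by case: K_cone => K0 _ _; eexists; exists (0, 0).
Qed.

Lemma lower_le_self v : lower p K v <= p v.
Proof.
by case: K_cone => K0 _ _; have := lower_le v K0; rewrite /= addr0 subr0.
Qed.

Lemma lower_sublinear : sublinear (lower p K).
Proof.
case: (p_sub) (K_cone) => pD pZ [K0 KD KZ]; split=> [u v|a u a0].
  rewrite -lerBlDr; apply: le_lower => x Kx.
  rewrite lerBlDl -lerBlDr; apply: le_lower => y Ky.
  rewrite lerBlDr; apply: le_trans (lower_le _ (KD _ _ Kx Ky)) _ => /=.
  have := pD (u + x.1) (v + y.1); rewrite addrACA; lra.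
have [->|an0] := eqVneq a 0.
  by rewrite scale0r mul0r -(sublinear0 p_sub) lower_le_self.
have apos : 0 < a by rewrite lt_neqAle eq_sym an0.
rewrite mulrC -ler_pdivrMr//; apply: le_lower => x Kx.
rewrite ler_pdivrMr// mulrC mulrBr.
apply: le_trans (lower_le _ (KZ a _ a0 Kx)) _ => /=.
by rewrite -scalerDr lerD2r pZ.
Qed.

Lemma lowerN x : K x -> lower p K (- x.1) <= - x.2.
Proof.
by move=> Kx; apply: le_trans (lower_le _ Kx) _; rewrite addNr sublinear0// sub0r.
Qed.

End Lower.

(** By minimality, lowering [p] along the ray through [y] leaves it unchanged;
    this gives [p (- y) <= - p y], so [p] is odd, hence additive. *)
Lemma minimal_sublinear_linear p : sublinear p ->
  (forall q, sublinear q -> (forall v, q v <= p v) -> q = p) -> linear_for *%R p.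
Proof.
move=> ps pmin; have [pD pZ] := ps.
have pN y : p (- y) = - p y.
  pose K := [set (t *: y, t * p y) | t in [set t : R | 0 <= t]].
  have Kc : convex_cone K.
    split=> [|_ _ [s /= s0 <-] [t /= t0 <-]|a _ /= a0 [t /= t0 <-]].
    - by exists 0 => //=; rewrite scale0r mul0r.
    - by exists (s + t); rewrite /= ?addr_ge0// scalerDl mulrDl.
    - by exists (a * t); rewrite /= ?mulr_ge0// scalerA mulrA.
  have Kp x : K x -> x.2 <= p x.1.
    move=> [t /= t0 <-] /=; have [->|tn0] := eqVneq t 0.
      by rewrite scale0r mul0r sublinear0.
    have tpos : 0 < t by rewrite lt_neqAle eq_sym tn0.
    rewrite mulrC -ler_pdivlMr// mulrC.
    have := pZ t^-1 (t *: y); rewrite scalerA mulVf// scale1r; apply.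
    by rewrite invr_ge0.
  have e : lower p K = p.
    apply: pmin; first exact: lower_sublinear.
    by move=> v; exact: lower_le_self.
  have Ky : K (y, p y) by exists 1; rewrite /= ?ler01// scale1r mul1r.
  apply/le_anti/andP; split.
    by have := lowerN ps Kp Ky; rewrite e.
  by have := pD y (- y); rewrite subrr sublinear0//; lra.
have pA x y : p (x + y) = p x + p y.
  apply/le_anti; rewrite pD/=.
  by have := pD (x + y) (- y); rewrite addrK pN; lra.
have pZ0 (a : R) x : 0 <= a -> p (a *: x) = a * p x.
  move=> a0; apply/le_anti; rewrite pZ//=.
  by have := pZ a (- x) a0; rewrite scalerN !pN; lra.
move=> a u v; rewrite pA; congr (_ + _).
have [a0|/ltW a0] := leP 0 a; first exact: pZ0.
have := pZ0 (- a) u; rewrite oppr_ge0 => /(_ a0).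
by rewrite scaleNr pN mulNr => /oppr_inj.
Qed.

(** Zorn's lemma applies because the pointwise infimum of a chain is sublinear: of
    any two members of the chain one is below the other. *)
Lemma minimal_sublinear p : sublinear p -> exists q,
  [/\ sublinear q, (forall v, q v <= p v) &
      forall q', sublinear q' -> (forall v, q' v <= q v) -> q' = q].
Proof.
move=> ps; pose S := {q : V -> R | sublinear q /\ forall v, q v <= p v}.
pose Le (s t : S) := `[< forall v, sval t v <= sval s v >].
have [||[s hs] [t ht] st ts|A totA|[q [qs qp]] qmin] := @Zorn S Le.
- by move=> t; apply/asboolP => v; exact: lexx.
- move=> r s t /asboolP rs /asboolP st; apply/asboolP => v.
  exact: le_trans (st v) (rs v).
- move/asboolP: st => st; move/asboolP: ts => ts.
  by apply: eq_exist; apply/funext => v; apply/le_anti/andP; split; [exact: ts|exact: st].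
- have [A0|/set0P[s0 As0]] := eqVneq A set0.
    have pS : sublinear p /\ forall v, p v <= p v by split.
    by exists (exist _ p pS) => s; rewrite A0.
  pose m v := inf [set sval s v | s in A].
  have mle s v : A s -> m v <= sval s v.
    move=> As; apply: ge_inf; last by exists s.
    exists (- p (- v)) => _ [t At <-].
    have [ts tp] := svalP t; apply: le_trans (_ : - sval t (- v) <= _).
      by rewrite lerN2.
    have := (ts.1 v (- v)); rewrite subrr sublinear0//; lra.
  have le_m b v : (forall s, A s -> b <= sval s v) -> b <= m v.
    move=> h; apply: lb_le_inf; first by eexists; exists s0.
    by move=> _ [s As <-]; exact: h.
  have ms : sublinear m.
    split=> [u v|a u a0].
      rewrite -lerBlDr; apply: (le_m _ _) => s As.
      rewrite lerBlDl -lerBlDr; apply: (le_m _ v) => t At; rewrite lerBlDr.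
      have [/asboolP st|/asboolP ts] := totA _ _ As At.
        apply: le_trans (mle _ _ At) _; apply: le_trans ((svalP t).1.1 _ _) _.
        by rewrite addrC lerD2l st.
      apply: le_trans (mle _ _ As) _; apply: le_trans ((svalP s).1.1 _ _) _.
      by rewrite addrC lerD2r ts.
    have [->|an0] := eqVneq a 0.
      rewrite scale0r mul0r; apply: le_trans (mle _ _ As0) _.
      by rewrite sublinear0//; case: (svalP s0).
    have apos : 0 < a by rewrite lt_neqAle eq_sym an0.
    rewrite mulrC -ler_pdivrMr//; apply: (le_m _ _) => s As.
    rewrite ler_pdivrMr// mulrC; apply: le_trans (mle _ _ As) _.
    exact: (svalP s).1.2.
  have mp v : m v <= p v.
    by apply: le_trans (mle _ _ As0) _; case: (svalP s0).
  by exists (exist _ m (conj ms mp)) => s As; apply/asboolP => v; exact: mle.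
exists q; split=> // q' q's q'q.
have q'p v : q' v <= p v by exact: le_trans (q'q v) (qp v).
have /(congr1 sval) : exist _ q' (conj q's q'p) = exist _ q (conj qs qp) :> S.
  by apply: qmin; apply/asboolP.
by [].
Qed.

(** The Mazur--Orlicz form of the Hahn--Banach theorem.  A minimal sublinear
    functional below [lower p K] is linear, and [lower p K (- x) <= - s] turns
    into the required lower bound [s] at [x]. *)
Lemma mazur_orlicz p K : sublinear p -> convex_cone K ->
    (forall x, K x -> x.2 <= p x.1) ->
  exists f : V -> R, [/\ linear_for *%R f, (forall v, f v <= p v) &
    forall x, K x -> x.2 <= f x.1].
Proof.
move=> ps Kc Kp.
have [f [fs fle fmin]] := minimal_sublinear (lower_sublinear ps Kc Kp).
have fl := minimal_sublinear_linear fs fmin.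
exists f; split=> // [v|x Kx].
  exact: le_trans (fle v) (lower_le_self ps Kc Kp v).
have fN : f (- x.1) = - f x.1.
  have := fl (-1) x.1 0; rewrite scaleN1r addr0 (sublinear0 fs) addr0 mulN1r.
  exact.
by rewrite -lerN2 -fN; apply: le_trans (fle _) (lowerN ps Kp Kx).
Qed.

End HahnBanach.

(** * Lattice expressions and their normal form *)

Section LatticeTerms.
Context (R : realType) (V : lmodType R).

Inductive lterm :=
  | LVar of V
  | LAdd of lterm & lterm
  | LScale of R & lterm
  | LJoin of lterm & lterm.

Fixpoint leval (Y : lmodType R) (j : Y -> Y -> Y) (T : V -> Y) (t : lterm) : Y :=
  match t with
  | LVar v => T v
  | LAdd s t => leval j T s + leval j T t
  | LScale a t => a *: leval j T t
  | LJoin s t => j (leval j T s) (leval j T t)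
  end.

(** Finite nonempty joins of vectors, kept as binary trees so that sums and positive
    multiples of joins are computed without a default value. *)
Inductive mtree := Leaf of V | Node of mtree & mtree.

Fixpoint meval (Y : lmodType R) (j : Y -> Y -> Y) (T : V -> Y) (t : mtree) : Y :=
  match t with
  | Leaf v => T v
  | Node s t => j (meval j T s) (meval j T t)
  end.

Fixpoint mshift v t :=
  match t with
  | Leaf w => Leaf (v + w)
  | Node s t => Node (mshift v s) (mshift v t)
  end.

Fixpoint madd s t :=
  match s with
  | Leaf v => mshift v t
  | Node s1 s2 => Node (madd s1 t) (madd s2 t)
  end.

Fixpoint mscale (a : R) t :=
  match t with
  | Leaf w => Leaf (a *: w)
  | Node s t => Node (mscale a s) (mscale a t)
  end.

Definition vlattice_join (Y : lmodType R) (j : Y -> Y -> Y) :=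
  (forall z x y, z + j x y = j (z + x) (z + y)) /\
  (forall (a : R) x y, 0 <= a -> a *: j x y = j (a *: x) (a *: y)).

Section Eval.
Variables (Y : lmodType R) (j : Y -> Y -> Y) (T : V -> Y).
Hypotheses (jP : vlattice_join j) (TL : linear T).

Lemma linear_fun0 : T 0 = 0.
Proof. by have := TL (-1) 0 0; rewrite !scaleN1r !addNr. Qed.
Lemma linear_funD u v : T (u + v) = T u + T v.
Proof. by have := TL 1 u v; rewrite !scale1r. Qed.
Lemma linear_funZ a u : T (a *: u) = a *: T u.
Proof. by have := TL a u 0; rewrite !addr0 linear_fun0 addr0. Qed.
Lemma linear_funN u : T (- u) = - T u.
Proof. by rewrite -scaleN1r linear_funZ scaleN1r. Qed.

Lemma meval_shift v t : meval j T (mshift v t) = T v + meval j T t.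
Proof.
elim: t => [w|s IHs t IHt] /=; first by rewrite linear_funD.
by rewrite IHs IHt -jP.1.
Qed.

Lemma meval_add s t : meval j T (madd s t) = meval j T s + meval j T t.
Proof.
elim: s => [v|s1 IH1 s2 IH2] /=; first exact: meval_shift.
by rewrite IH1 IH2 ![_ + meval j T t]addrC -jP.1.
Qed.

Lemma meval_scale a t : 0 <= a -> meval j T (mscale a t) = a *: meval j T t.
Proof.
move=> a0; elim: t => [w|s IHs t IHt] /=; first by rewrite linear_funZ.
by rewrite IHs IHt jP.2.
Qed.

End Eval.

(** Every lattice expression is a difference of two finite joins of vectors,
    through the identity
    [(a - b) \/ (c - d) = ((a + d) \/ (c + b)) - (b + d)]. *)
Fixpoint normal_form (t : lterm) : mtree * mtree :=
  match t with
  | LVar v => (Leaf v, Leaf 0)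
  | LAdd s t => let: (a, b) := normal_form s in let: (c, d) := normal_form t in
     (madd a c, madd b d)
  | LScale x t => let: (a, b) := normal_form t in
     if 0 <= x then (mscale x a, mscale x b) else (mscale (- x) b, mscale (- x) a)
  | LJoin s t => let: (a, b) := normal_form s in let: (c, d) := normal_form t in
     (Node (madd a d) (madd c b), madd b d)
  end.

Lemma leval_normal_form (Y : lmodType R) (j : Y -> Y -> Y) (T : V -> Y) t :
  vlattice_join j -> linear T ->
  leval j T t = meval j T (normal_form t).1 - meval j T (normal_form t).2.
Proof.
move=> jP TL; elim: t => [v|s IHs t IHt|x t IHt|s IHs t IHt] /=.
- by rewrite linear_fun0// subr0.
- rewrite IHs IHt; case: (normal_form s) => a b; case: (normal_form t) => c d /=.
  by rewrite !meval_add// opprD addrACA.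
- rewrite IHt; case: (normal_form t) => c d /=; case: ifPn => x0 /=.
    by rewrite !meval_scale// scalerBr.
  rewrite -ltNge in x0.
  rewrite !meval_scale ?oppr_ge0 ?(ltW x0)//.
  by rewrite !scaleNr opprK scalerBr addrC.
- rewrite IHs IHt; case: (normal_form s) => a b; case: (normal_form t) => c d /=.
  rewrite !meval_add//; apply/eqP; rewrite -subr_eq opprK addrC jP.1; apply/eqP.
  have aux (x y z : Y) : y + z + (x - y) = x + z by rewrite addrC addrA subrK.
  by rewrite aux [X in X + (_ - _)]addrC aux.
Qed.

End LatticeTerms.

Lemma max_vlattice_join (R : realType) :
  vlattice_join (Y := R^o) (@Order.max _ R : R^o -> R^o -> R^o).
Proof.
split=> [z x y|a x y a0]; first by rewrite /= addr_maxr.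
by rewrite /GRing.scale/= maxr_pMr.
Qed.

(** * Positivity of lattice expressions *)

Section Positivity.
Context (R : realType) (V : normedModType R).

Definition unit_functional (f : V -> R) :=
  linear_for *%R f /\ forall v, f v <= `|v|.

Lemma unit_functional_norm f v : unit_functional f -> `|f v| <= `|v|.
Proof.
move=> [fL fle]; rewrite ler_norml fle andbT lerNl.
rewrite -(linear_funN (Y := R^o) fL).
by rewrite -(normrN v).
Qed.

Lemma norm_sublinear : sublinear (fun v : V => `|v|).
Proof.
by split=> [u v|a u a0]; [exact: ler_normD|rewrite normrZ ger0_norm].
Qed.

(** The cone of constraints is the ray through [(v, |v|)]. *)
Lemma norming_functional (v : V) : exists2 f, unit_functional f & f v = `|v|.
Proof.
pose K := [set (t *: v, t * `|v|) | t in [set t : R | 0 <= t]].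
have [||f [fL fle fK]] := mazur_orlicz (K := K) norm_sublinear.
- split=> [|_ _ [s /= s0 <-] [t /= t0 <-]|a _ /= a0 [t /= t0 <-]].
  + by exists 0 => //=; rewrite scale0r mul0r.
  + by exists (s + t); rewrite /= ?addr_ge0// scalerDl mulrDl.
  + by exists (a * t); rewrite /= ?mulr_ge0// scalerA mulrA.
- by move=> _ [t /= t0 <-]; rewrite normrZ ger0_norm.
exists f => //; apply/le_anti; rewrite fle/=; apply: (fK (v, `|v|)).
by exists 1; rewrite /= ?ler01// scale1r mul1r.
Qed.

(** The convex cone spanned by the pairs [(v, 1)], [v] a leaf of the tree: the
    points [(x, 1)] of it are the convex combinations [x] of the leaves. *)
Fixpoint leaf_cone (t : mtree V) : set (V * R) :=
  match t with
  | Leaf v => [set (s *: v, s) | s in [set s : R | 0 <= s]]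
  | Node a b => [set (x.1 + y.1, x.2 + y.2) | x in leaf_cone a & y in leaf_cone b]
  end.

Lemma leaf_cone_convex t : convex_cone (leaf_cone t).
Proof.
elim: t => [v|a [a0 aD aZ] b [b0 bD bZ]].
  split=> [|_ _ [s /= s0 <-] [t /= t0 <-]|a _ /= a0 [t /= t0 <-]].
  + by exists 0; rewrite /= ?scale0r.
  + by exists (s + t); rewrite /= ?addr_ge0// scalerDl.
  + by exists (a * t); rewrite /= ?mulr_ge0// scalerA.
split.
- by exists (0, 0) => //; exists (0, 0) => //=; rewrite !addr0.
- move=> _ _ [x ax [y bY <-]] [z az [w bw <-]].
  exists (x.1 + z.1, x.2 + z.2); first exact: aD.
  exists (y.1 + w.1, y.2 + w.2); first exact: bD.
  by congr (_, _); exact: addrACA.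
- move=> r _ r0 [x ax [y bY <-]].
  exists (r *: x.1, r * x.2); first exact: aZ.
  exists (r *: y.1, r * y.2); first exact: bZ.
  by rewrite /= scalerDr mulrDr.
Qed.

Lemma leaf_cone_ge0 t x : leaf_cone t x -> 0 <= x.2.
Proof.
elim: t x => [v|a IHa b IHb] x /=; first by move=> [s s0 <-].
by move=> [y /IHa y0 [z /IHb z0 <-]]; rewrite /= addr_ge0.
Qed.

(** Gordan's alternative, in a form that needs no compactness: if all convex
    combinations of the leaves have norm at least [e], then a functional
    dominated by the norm is at least [e] at each leaf, and its opposite is
    negative at all of them. *)
Lemma gordan (t : mtree V) :
    (forall f, unit_functional f -> 0 <= meval (Y := R^o) Num.max f t) ->
  forall e : R, 0 < e -> exists2 x, leaf_cone t (x, 1) & `|x| <= e.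
Proof.
move=> h e e0; apply: contrapT => /forall2NP hx.
have {}hx x : leaf_cone t (x, 1) -> e < `|x|.
  by move=> cx; have [|/negP] := hx x; [|rewrite -ltNge].
have [t0 tD tZ] := leaf_cone_convex t.
pose K := [set (x.1, x.2 * e) | x in leaf_cone t].
have [||f [fL fle fK]] := mazur_orlicz (K := K) norm_sublinear.
- split=> [|_ _ [x cx <-] [y cy <-]|a _ a0 [x cx <-]].
  + by exists (0, 0) => //=; rewrite mul0r.
  + by exists (x.1 + y.1, x.2 + y.2) => /=; [exact: tD|rewrite mulrDl].
  + by exists (a *: x.1, a * x.2) => /=; [exact: tZ|rewrite mulrA].
- move=> _ [[x s] cx <-] /=; have /= s0 := leaf_cone_ge0 cx.
  have [->|sn0] := eqVneq s 0; first by rewrite mul0r.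
  have spos : 0 < s by rewrite lt_neqAle eq_sym sn0.
  rewrite mulrC -ler_pdivlMr//; apply/ltW.
  have /= := tZ s^-1 _ _ cx; rewrite mulVf// invr_ge0 => /(_ s0)/hx.
  by rewrite normrZ ger0_norm ?invr_ge0// mulrC.
have fN := linear_funN (Y := R^o) fL.
have /h : unit_functional (fun v => f (- v)).
  split=> [a u v|v]; last by rewrite -(normrN v).
  by rewrite -fL opprD scalerN.
suff : meval (Y := R^o) Num.max (fun v => f (- v)) t <= - e.
  by move=> le1 /le_trans/(_ le1); rewrite lerNr oppr0 leNgt e0.
have {}fK : forall x, leaf_cone t x -> x.2 * e <= f x.1.
  by move=> x cx; apply: (fK (x.1, x.2 * e)); exists x.
elim: t {h hx t0 tD tZ K} fK => [v|a IHa b IHb] /= fK.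
  by have := fK (v, 1); rewrite /= fN mul1r lerN2; apply; exists 1; rewrite /= ?scale1r.
have [a0 _ _] := leaf_cone_convex a; have [b0 _ _] := leaf_cone_convex b.
rewrite ge_max; apply/andP; split.
  apply: IHa => x cx; apply: fK; exists x => //; exists (0, 0) => //=.
  by rewrite !addr0; case: x {cx}.
apply: IHb => x cx; apply: fK; exists (0, 0) => //; exists x => //=.
by rewrite !add0r; case: x {cx}.
Qed.

Context (X : banachLatticeType R).

Lemma join_vlattice : vlattice_join (Y := X) (@Order.join _ X).
Proof. by split=> [z x y|a x y a0]; [exact: bl_joinDr|exact: bl_joinZ]. Qed.

Lemma meval_ge_leaf_cone (T : V -> X) t x : linear T -> leaf_cone t x ->
  T x.1 <= x.2 *: meval (@Order.join _ X) T t.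
Proof.
move=> TL; elim: t x => [v|a IHa b IHb] x /=.
  by move=> [s s0 <-] /=; rewrite linear_funZ.
move=> [y ay [z bz <-]] /=; rewrite linear_funD// scalerDl.
apply: blD.
  by apply: le_trans (IHa _ ay) _; apply: blZ; [exact: leaf_cone_ge0 ay|exact: leUl].
by apply: le_trans (IHb _ bz) _; apply: blZ; [exact: leaf_cone_ge0 bz|exact: leUr].
Qed.

(** In normal form, positivity of a lattice expression is a family of
    inequalities [0 <= join of the v_i].  Since a join dominates the convex
    combinations, and [T] is bounded, Gordan's alternative reduces them to the
    real-valued case.  This is what makes the extension of [T] to lattice
    expressions well defined and monotone. *)
Theorem leval_ge0 (T : V -> X) (C : R) t : linear T ->
    (forall v, `|T v| <= C * `|v|) ->
    (forall f, unit_functional f -> 0 <= leval (Y := R^o) Num.max f t) ->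
  0 <= leval (@Order.join _ X) T t.
Proof.
move=> TL TC h; rewrite (leval_normal_form t join_vlattice TL) bl_subr_ge0.
have {h} : forall f, unit_functional f ->
    meval (Y := R^o) Num.max f (normal_form t).2 <=
    meval (Y := R^o) Num.max f (normal_form t).1.
  move=> f uf; have := h f uf.
  by rewrite (leval_normal_form (Y := R^o) t (max_vlattice_join R) uf.1) subr_ge0.
case: (normal_form t) => a b /=.
elim: b => [v|b1 IH1 b2 IH2] /= h; last first.
  rewrite leUx; apply/andP; split.
    by apply: IH1 => f /h; apply: le_trans; rewrite le_max lexx.
  by apply: IH2 => f /h; apply: le_trans; rewrite le_max lexx orbT.
apply: bl_le_closed => e e0.
have C1 : 0 < `|C| + 1 by rewrite ltr_wpDl.
have [||x cx xe] := @gordan (mshift (- v) a) _ (e / (`|C| + 1)).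
- move=> f uf; rewrite (meval_shift (Y := R^o) (max_vlattice_join R) uf.1).
  by rewrite (linear_funN (Y := R^o) uf.1) addrC subr_ge0 h.
- by rewrite divr_gt0.
exists (- T x).
  have := meval_ge_leaf_cone TL cx; rewrite /= scale1r (meval_shift join_vlattice TL).
  rewrite linear_funN//.
  by rewrite blBrDl -[X in _ -> _ <= X]addrC blBrDl addrC.
rewrite normrN; apply: le_trans (TC x) _.
apply: (@le_trans _ _ ((`|C| + 1) * `|x|)).
  apply: ler_wpM2r => //; apply: le_trans (ler_norm _) _; lra.
by rewrite mulrC -ler_pdivlMr.
Qed.

End Positivity.

(** * Extension by density *)

Lemma cauchy_seq_cvg (R : realType) (X : completeNormedModType R) (u : nat -> X) :
    (forall e : R, 0 < e -> exists N, forall n m,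
       (N <= n)%N -> (N <= m)%N -> `|u n - u m| <= e) ->
  exists l : X, forall e : R, 0 < e -> exists N, forall n,
    (N <= n)%N -> `|u n - l| <= e.
Proof.
move=> uC; have /cvgrPdist_le ul : cvgn u.
  apply/cauchy_cvgP; apply: cauchy_exP => e e0.
  have [N uN] := uC (e / 2) (divr_gt0 e0 (ltr0n R 2)).
  exists (u N); exists N => // n /= Nn; rewrite -ball_normE /ball_/=.
  by apply: le_lt_trans (uN _ _ (leqnn N) Nn) _; rewrite ltr_pdivrMr//; lra.
exists (limn u) => e e0; have [N _ uN] := ul _ e0.
by exists N => n Nn; rewrite distrC; exact: uN.
Qed.

Lemma archi_inv (R : realType) (e : R) : 0 < e ->
  exists N, forall n, (N <= n)%N -> n.+1%:R^-1 <= e.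
Proof.
move=> e0; exists (Num.truncn e^-1) => n Nn.
rewrite -[leRHS]invrK lef_pV2 ?posrE ?invr_gt0//.
by apply/ltW; apply: lt_le_trans (Num.Theory.truncnS_gt _) _; rewrite ler_nat.
Qed.

Section DenseExtension.
Context (R : realType) (X : banachLatticeType R) (Y : lmodType R).
Variables (jY : Y -> Y -> Y) (near : R -> Y -> Y -> Prop).
Variables (G : Y -> X -> Prop) (C : R).
Hypothesis C0 : 0 <= C.
Hypothesis near_sym : forall e h g, near e h g -> near e g h.
Hypothesis near_trans : forall e e' f g h,
  near e f g -> near e' g h -> near (e + e') f h.
Hypothesis near_lin : forall (a : R) e e' h g h' g',
  near e h g -> near e' h' g' -> near (`|a| * e + e') (a *: h + h') (a *: g + g').
Hypothesis near_join : forall e e' h g h' g',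
  near e h g -> near e' h' g' -> near (e + e') (jY h h') (jY g g').
Hypothesis G_lin : forall (a : R) h g y z,
  G h y -> G g z -> G (a *: h + g) (a *: y + z).
Hypothesis G_join : forall h g y z,
  G h y -> G g z -> G (jY h g) (Order.join y z).
Hypothesis G_bounded : forall e h g y z,
  G h y -> G g z -> near e h g -> `|y - z| <= C * e.

Definition approximable h := forall e, 0 < e -> exists g y, G g y /\ near e h g.

(** The graph [G] of a bounded vector lattice homomorphism extends by continuity
    to the vectors that it approximates.  A relation [near] stands for the norm
    of [Y], because for the functional calculus it is the gauge
    [|h s - g s| <= e |s|], which is finite only at some functions. *)
Lemma dense_extension : exists Phi : Y -> X,
  [/\ forall h, approximable h -> forall e g y,
        G g y -> near e h g -> `|Phi h - y| <= C * e,
      forall (a : R) h h', approximable h -> approximable h' ->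
        Phi (a *: h + h') = a *: Phi h + Phi h' &
      forall h h', approximable h -> approximable h' ->
        Phi (jY h h') = Order.join (Phi h) (Phi h')].
Proof.
have ex h : exists y, approximable h -> forall e g z,
    G g z -> near e h g -> `|y - z| <= C * e.
  have [ah|nah] := pselect (approximable h); last by exists 0.
  have /choice[g hg] : forall n : nat, exists gy : Y * X,
      G gy.1 gy.2 /\ near n.+1%:R^-1 h gy.1.
    move=> n; have [|g [y [Gy nh]]] := ah n.+1%:R^-1; first by rewrite invr_gt0.
    by exists (g, y).
  have [|l ul] := @cauchy_seq_cvg R X (fun n => (g n).2).
    move=> e e0; have e2 : 0 < e / (2 * (C + 1)).
      by rewrite divr_gt0// mulr_gt0// ltr_wpDl.
    have [N NP] := archi_inv e2; exists N => n m Nn Nm.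
    have [Gn nn] := hg n; have [Gm nm] := hg m.
    apply: le_trans (G_bounded Gn Gm (near_trans (near_sym nn) nm)) _.
    apply: (@le_trans _ _ ((C + 1) * (e / (2 * (C + 1)) + e / (2 * (C + 1))))).
      have i0 : 0 <= e / (2 * (C + 1)) + e / (2 * (C + 1)) by rewrite addr_ge0// ltW.
      apply: (@le_trans _ _ (C * (e / (2 * (C + 1)) + e / (2 * (C + 1))))).
        by rewrite ler_wpM2l// lerD// NP.
      by rewrite ler_wpM2r//; lra.
    rewrite le_eqVlt; apply/orP; left; apply/eqP; field.
    by rewrite gt_eqF// ltr_wpDl.
  exists l => _ e f z Gf nf; apply/ler_addgt0Pr => d d0.
  have d2 : 0 < d / (2 * (C + 1)) by rewrite divr_gt0// mulr_gt0// ltr_wpDl.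
  have [N NP] := archi_inv d2; have [M MP] := ul _ (divr_gt0 d0 (ltr0n R 2)).
  pose n := maxn N M; have [Gn nn] := hg n.
  have h1 := MP n (leq_maxr _ _).
  have h2 := G_bounded Gn Gf (near_trans (near_sym nn) nf).
  have h3 := NP n (leq_maxl _ _).
  have h4 : C * n.+1%:R^-1 <= d / 2.
    apply: (@le_trans _ _ ((C + 1) * (d / (2 * (C + 1))))).
      apply: (@le_trans _ _ (C * (d / (2 * (C + 1))))); first by rewrite ler_wpM2l.
      by rewrite ler_wpM2r ?(ltW d2)//; lra.
    rewrite le_eqVlt; apply/orP; left; apply/eqP; field.
    by rewrite gt_eqF// ltr_wpDl.
  rewrite -(subrKA (g n).2); apply: le_trans (ler_normD _ _) _.
  rewrite -[X in X + _]normrN opprB; apply: le_trans (lerD h1 h2) _.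
  by rewrite mulrDr addrA (addrC _ d) lerD2r [leRHS]splitr lerD2l.
have [Phi hPhi] := choice ex; exists Phi.
have eq0 (x y : X) : (forall e, 0 < e -> `|x - y| <= C * e) -> x = y.
  move=> xy; apply/eqP; rewrite -subr_eq0 -normr_le0; apply/ler_addgt0Pr => d d0.
  rewrite add0r; have C1 : 0 < C + 1 by rewrite ltr_wpDl.
  apply: le_trans (xy (d / (C + 1)) (divr_gt0 d0 C1)) _.
  rewrite mulrA ler_pdivrMr// mulrC ler_wpM2l ?(ltW d0)//; lra.
split=> // [a h h' ah ah'|h h' ah ah'].
- have aa : approximable (a *: h + h').
    move=> e e0; have a1 : 0 < `|a| + 1 by rewrite ltr_wpDl.
    have [g [y [Gg ng]]] := ah _ (divr_gt0 e0 a1).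
    have [g' [y' [Gg' ng']]] := ah' _ (divr_gt0 e0 a1).
    exists (a *: g + g'), (a *: y + y'); split; first exact: G_lin.
    have -> : e = `|a| * (e / (`|a| + 1)) + e / (`|a| + 1).
      by field; rewrite gt_eqF.
    exact: near_lin.
  apply: eq0 => e e0; have a1 : 0 < 2 * (`|a| + 1) by rewrite mulr_gt0// ltr_wpDl.
  set d := e / (2 * (`|a| + 1)); have d0 : 0 < d by rewrite divr_gt0.
  have [g [y [Gg ng]]] := ah _ d0; have [g' [y' [Gg' ng']]] := ah' _ d0.
  have h1 := hPhi _ aa _ _ _ (G_lin a Gg Gg') (near_lin a ng ng').
  have h2 := hPhi _ ah _ _ _ Gg ng; have h3 := hPhi _ ah' _ _ _ Gg' ng'.
  rewrite -(subrKA (a *: y + y')); apply: le_trans (ler_normD _ _) _.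
  rewrite [X in _ + `|X|](_ : _ = - (a *: (Phi h - y) + (Phi h' - y'))); last first.
    by rewrite scalerBr addrACA -opprD opprB.
  rewrite normrN; apply: le_trans (lerD h1 (ler_normD _ _)) _.
  rewrite normrZ.
  apply: le_trans (lerD (lexx _) (lerD (ler_wpM2l (normr_ge0 a) h2) h3)) _.
  rewrite le_eqVlt; apply/orP; left; apply/eqP; rewrite /d; field.
  by rewrite gt_eqF// ltr_wpDl.
- have aa : approximable (jY h h').
    move=> e e0; have e2 := divr_gt0 e0 (ltr0n R 2).
    have [g [y [Gg ng]]] := ah _ e2; have [g' [y' [Gg' ng']]] := ah' _ e2.
    exists (jY g g'), (Order.join y y'); split; first exact: G_join.
    by rewrite [e]splitr; exact: near_join.
  apply: eq0 => e e0.
  set d := e / 4; have d0 : 0 < d by rewrite divr_gt0.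
  have [g [y [Gg ng]]] := ah _ d0; have [g' [y' [Gg' ng']]] := ah' _ d0.
  have h1 := hPhi _ aa _ _ _ (G_join Gg Gg') (near_join ng ng').
  have h2 := hPhi _ ah _ _ _ Gg ng; have h3 := hPhi _ ah' _ _ _ Gg' ng'.
  rewrite -(subrKA (Order.join y y')); apply: le_trans (ler_normD _ _) _.
  rewrite [X in _ + X]distrC; apply: le_trans (lerD h1 (norm_joinB _ _ _ _)) _.
  apply: le_trans (lerD (lexx _) (lerD h2 h3)) _.
  by rewrite le_eqVlt; apply/orP; left; apply/eqP; rewrite /d; field.
Qed.

End DenseExtension.

(** * Positively homogeneous continuous functions *)

Section PosHom.
Context (R : realType) (m : nat).
Implicit Types (h g : 'rV[R]_m -> R).

Lemma poshom_cst0 : poshom_continuous (fun _ : 'rV[R]_m => 0 : R).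
Proof. by split=> [x|t s _]; [exact: cst_continuous|rewrite mulr0]. Qed.

Lemma poshom_coord k : poshom_continuous (fun s : 'rV[R]_m => s ord0 k).
Proof. by split=> [|t s _]; [exact: coord_continuous|rewrite mxE]. Qed.

Lemma poshom_lin (a : R) h g : poshom_continuous h -> poshom_continuous g ->
  poshom_continuous (fun s => a * h s + g s).
Proof.
move=> [hc hh] [gc gh]; split=> [x|t s t0]; last by rewrite hh// gh// mulrDr mulrCA.
exact: (continuousD (continuousM (@cst_continuous _ _ a x) (hc x)) (gc x)).
Qed.

Lemma poshom_max h g : poshom_continuous h -> poshom_continuous g ->
  poshom_continuous (fun s => Num.max (h s) (g s)).
Proof.
move=> [hc hh] [gc gh]; split=> [x|t s t0]; last by rewrite hh// gh// maxr_pMr.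
exact: (continuous_max (hc x) (gc x)).
Qed.

Lemma poshom_norm : poshom_continuous (fun s : 'rV[R]_m => `|s|).
Proof.
split=> [x|t s t0]; last by rewrite normrZ ger0_norm.
exact: norm_continuous.
Qed.

Definition dotv (s v : 'rV[R]_m) : R := \sum_(k < m) v ord0 k * s ord0 k.

Lemma dotv_linear s : linear (dotv s : 'rV[R]_m -> R^o).
Proof.
move=> a u v; rewrite /dotv scaler_sumr -big_split/=; apply: eq_bigr => k _.
by rewrite !mxE mulrDl /GRing.scale/= mulrA.
Qed.

Definition lfun (t : lterm 'rV[R]_m) (s : 'rV[R]_m) : R :=
  leval (Y := R^o) Num.max (dotv s) t.

Lemma lfunD t u s : lfun (LAdd t u) s = lfun t s + lfun u s.
Proof. by []. Qed.
Lemma lfunZ a t s : lfun (LScale a t) s = a * lfun t s.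
Proof. by []. Qed.
Lemma lfunJ t u s : lfun (LJoin t u) s = Num.max (lfun t s) (lfun u s).
Proof. by []. Qed.

Lemma poshom_lfun t : poshom_continuous (lfun t).
Proof.
elim: t => [v|s IHs t IHt|a t IHt|s IHs t IHt].
- rewrite /lfun /= /dotv; elim: (index_enum _) => [|k r IHr].
    by under eq_fun do rewrite big_nil; exact: poshom_cst0.
  under eq_fun do rewrite big_cons; apply: poshom_lin => //; exact: poshom_coord.
- have := poshom_lin 1 IHs IHt; congr poshom_continuous.
  by apply/funext => x; rewrite mul1r.
- have := poshom_lin a IHt poshom_cst0; congr poshom_continuous.
  by apply/funext => x; rewrite addr0.
- exact: poshom_max.
Qed.

Lemma coord_le_norm (w : 'rV[R]_m) k : `|w ord0 k| <= `|w|.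
Proof.
rewrite [leRHS]mx_normrE; apply: (le_trans _ (le_bigmax _ _ (ord0, k))).
exact: lexx.
Qed.

Definition tabs (t : lterm 'rV[R]_m) := LJoin t (LScale (-1) t).
Definition tvar k : lterm 'rV[R]_m := LVar (delta_mx ord0 k).
Definition tmin (s t : lterm 'rV[R]_m) :=
  LScale (-1) (LJoin (LScale (-1) s) (LScale (-1) t)).
(** The maximum of the absolute values of the [f k]; at the coordinates this is the
    norm of the row vector. *)
Definition tnorm_of (f : 'I_m -> lterm 'rV[R]_m) :=
  foldr (fun k t => LJoin (tabs (f k)) t) (LVar 0) (index_enum 'I_m).
Definition tnorm := tnorm_of tvar.

Lemma lfun_abs t s : lfun (tabs t) s = `|lfun t s|.
Proof.
rewrite lfunJ lfunZ mulN1r; have [a0|a0] := leP 0 (lfun t s).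
  by rewrite ger0_norm// max_l//; lra.
by rewrite ltr0_norm// max_r//; lra.
Qed.

Lemma lfun_var k s : lfun (tvar k) s = s ord0 k.
Proof.
rewrite /lfun /= /dotv (bigD1 k)//= mxE !eqxx mul1r big1 ?addr0// => i ik.
by rewrite mxE (negPf ik) andbF mul0r.
Qed.

Lemma lfun_min t u s : lfun (tmin t u) s = Num.min (lfun t s) (lfun u s).
Proof. by rewrite lfunZ lfunJ !lfunZ !mulN1r oppr_max !opprK. Qed.

Lemma lfun_norm_of f s (w : 'rV[R]_m) : (forall k, lfun (f k) s = w ord0 k) ->
  lfun (tnorm_of f) s = `|w|.
Proof.
move=> fw; apply/le_anti/andP; split.
  rewrite /tnorm_of; elim: (index_enum _) => [|k r IHr] /=.
    by rewrite /lfun /= (linear_fun0 (@dotv_linear s)).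
  by rewrite lfunJ ge_max IHr andbT lfun_abs fw coord_le_norm.
rewrite [`|w|]mx_normrE; apply: bigmax_le => [|[i k] _] /=; rewrite /tnorm_of.
  elim: (index_enum _) => [|k r IHr] /=.
    by rewrite /lfun /= (linear_fun0 (@dotv_linear s)).
  by rewrite lfunJ le_max IHr orbT.
rewrite (ord1 i) -fw; have := mem_index_enum k.
elim: (index_enum _) => [|j r IHr] //=; rewrite inE lfunJ le_max => /predU1P[<-|/IHr->].
  by rewrite lfun_abs lexx.
by rewrite orbT.
Qed.

Lemma lfun_norm s : lfun tnorm s = `|s|.
Proof. by apply: lfun_norm_of => k; rewrite lfun_var. Qed.

End PosHom.

(** * Density of the lattice expressions *)

Section Density.
Context (R : realType) (m : nat).

(** A finite subcover of the cover by balls, whose radius depends on the centre. *)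
Lemma compact_net (A : set 'rV[R]_m) (r : 'rV[R]_m -> R) : compact A ->
    (forall g, 0 < r g) ->
  exists gs : seq 'rV[R]_m, (forall g, g \in gs -> A g) /\
    forall s, A s -> exists2 g, g \in gs & `|s - g| < r g.
Proof.
rewrite compact_cover => Aco r0.
have [|s As|D' DA AD'] := Aco 'rV[R]_m A (fun g => ball g (r g)).
- by move=> g _; exact: ball_open.
- by exists s => //; exact: ballxx.
exists (finmap.enum_fset D'); split=> [g gD|s /AD'[g /= gD]].
  by apply/set_mem; exact: DA.
rewrite -ball_normE /ball_/= => gs.
by exists g => //; rewrite distrC.
Qed.

Lemma rv_ball_compact : compact [set s : 'rV[R]_m | `|s| <= 1].
Proof.
apply: bounded_closed_compact.
  by exists 1; split=> // x x1 s /= s1; apply: le_trans s1 (ltW x1).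
rewrite (_ : [set _ | _] = (fun s : 'rV[R]_m => `|s|) @^-1` [set x : R | x <= 1])//.
by apply: preimage_closed (@closed_le R 1) => s _; exact: norm_continuous.
Qed.

Lemma poshom0 (h : 'rV[R]_m -> R) : poshom_continuous h -> h 0 = 0.
Proof. by move=> [_ hh]; have := hh 0 0 (lexx _); rewrite scale0r mul0r. Qed.

(** The lattice version of the Stone--Weierstrass theorem, for positively
    homogeneous functions.  The approximant is the McShane infimum
    [min_g (h g + K_g |s - g|)] over a finite net of the unit ball, made positively
    homogeneous. *)
Theorem lfun_dense (h : 'rV[R]_m -> R) (e : R) : poshom_continuous h -> 0 < e ->
  exists t, forall s, `|h s - lfun t s| <= e * `|s|.
Proof.
move=> hP e0; have [hc hh] := hP.
have hcg (g : 'rV[R]_m) : exists2 d : R, 0 < d &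
    forall s : 'rV[R]_m, `|s - g| < d -> `|h s - h g| < e / 3.
  have /cvgrPdist_lt/(_ (e / 3)) := hc g; rewrite divr_gt0// => /(_ isT).
  move=> /nbhs_ballP[d /= d0 dh]; exists d => // s sg; rewrite distrC; apply: dh.
  by rewrite -ball_normE /ball_/= distrC.
have /choice[d hd] : forall g : 'rV[R]_m, exists d : R, 0 < d /\
    forall s : 'rV[R]_m, `|s - g| < d -> `|h s - h g| < e / 3.
  by move=> g; have [d d0 dh] := hcg g; exists d.
have d0 (g : 'rV[R]_m) : 0 < d g by case: (hd g).
have [B B0 hB] : exists2 B : R, 0 < B & forall s : 'rV[R]_m, `|s| <= 1 -> `|h s| <= B.
  have [gs [_ gsP]] := compact_net rv_ball_compact d0.
  exists (\sum_(g <- gs) `|h g| + e).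
    by rewrite ltr_wpDl// sumr_ge0.
  move=> s /gsP[g ggs /(hd g).2 hsg].
  have hg : `|h g| <= \sum_(g <- gs) `|h g|.
    by rewrite (big_rem g)//= lerDl sumr_ge0.
  by have := ler_distD 0 (h s) (h g); have := ler_distD (h g) (h s) 0;
    rewrite !subr0; lra.
(* The slope [K g] makes the cone over [g] exceed [2 B >= h s - h g] as soon as
   [s] is at distance [d g] from [g]. *)
pose K (g : 'rV[R]_m) : R := 2 * B / d g.
pose r (g : 'rV[R]_m) : R := Num.min (d g) (e / 3 / K g).
have K0 (g : 'rV[R]_m) : 0 < K g by rewrite divr_gt0// mulr_gt0.
have r0 (g : 'rV[R]_m) : 0 < r g by rewrite lt_min d0 (divr_gt0 _ (K0 g))// divr_gt0.
have [gs [gs1 gsP]] := compact_net rv_ball_compact r0.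
pose tg (g : 'rV[R]_m) := LAdd (LScale (h g + e / 3) (tnorm R m))
  (LScale (K g) (tnorm_of
     (fun k => LAdd (tvar R k) (LScale (- g ord0 k) (tnorm R m))))).
have tgE (g s : 'rV[R]_m) : lfun (tg g) s =
    (h g + e / 3) * `|s| + K g * `|s - `|s| *: g|.
  rewrite lfunD !lfunZ lfun_norm; congr (_ + _ * _).
  apply: lfun_norm_of => k; rewrite lfunD lfunZ lfun_var lfun_norm !mxE.
  by rewrite mulNr mulrC.
have tgZ (g s : 'rV[R]_m) : s != 0 -> lfun (tg g) s =
    `|s| * (h g + e / 3 + K g * `| `|s|^-1 *: s - g|).
  move=> s0; rewrite tgE.
  have -> : `|s - `|s| *: g| = `|s| * `| `|s|^-1 *: s - g|.
    rewrite -[X in X * _](normr_id s) -normrZ scalerBr scalerA mulfV ?scale1r//.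
    by rewrite normr_eq0.
  ring.
have hu (s : 'rV[R]_m) : s != 0 -> h s = `|s| * h (`|s|^-1 *: s).
  by move=> s0; rewrite -hh// scalerA mulfV ?scale1r// normr_eq0.
have nu (s : 'rV[R]_m) : s != 0 -> `| `|s|^-1 *: s| = 1.
  by move=> s0; rewrite normrZ normfV normr_id mulVf// normr_eq0.
have tg0 (g : 'rV[R]_m) : lfun (tg g) 0 = 0.
  by rewrite tgE normr0 scale0r subr0 normr0 !mulr0 addr0.
have ge_h (g s : 'rV[R]_m) : `|g| <= 1 -> h s <= lfun (tg g) s.
  move=> g1; have [->|s0] := eqVneq s 0; first by rewrite poshom0// tg0.
  rewrite tgZ// hu//; set u := _ *: s; rewrite ler_wpM2l//.
  have [ud|ud] := ltP `|u - g| (d g).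
    have := (hd g).2 _ ud; have := mulr_ge0 (ltW (K0 g)) (normr_ge0 (u - g)).
    by have := ler_norm (h u - h g); lra.
  have : 2 * B <= K g * `|u - g|.
    rewrite /K -mulrA ler_peMr ?mulr_ge0 ?(ltW B0)//.
    by rewrite mulrC ler_pdivlMr// mul1r.
  have := hB u; rewrite nu// => /(_ (lexx _)); have := hB g g1.
  have := ler_norm (h u); have := ler_norm (- h g); rewrite normrN; lra.
pose t := foldr (fun g t => tmin (tg g) t) (tg 0) gs.
have tge (s : 'rV[R]_m) : h s <= lfun t s.
  rewrite /t; elim: gs gs1 {gsP t} => [_|g gs IH gs1] /=.
    by apply: ge_h; rewrite normr0 ler01.
  rewrite lfun_min le_min IH ?andbT; last first.
    by move=> k kgs; apply: gs1; rewrite inE kgs orbT.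
  by apply: ge_h; apply: gs1; rewrite mem_head.
have tle (g s : 'rV[R]_m) : g \in gs -> lfun t s <= lfun (tg g) s.
  rewrite /t; elim: gs {gs1 gsP t tge} => [|k gs IH] //=.
  rewrite inE lfun_min ge_min => /predU1P[->|/IH ->]; first by rewrite lexx.
  by rewrite orbT.
exists t => s; rewrite distrC ger0_norm ?subr_ge0// lerBlDr.
have [->|s0] := eqVneq s 0.
  by rewrite (poshom0 (poshom_lfun t)) (poshom0 hP) normr0 mulr0 addr0.
set u := `|s|^-1 *: s; have [|g ggs] := gsP u; first by rewrite /= nu.
rewrite lt_min => /andP[ud uK]; apply: le_trans (tle g s ggs) _.
rewrite tgZ// [h s]hu// -/u (mulrC e `|s|) -mulrDr ler_wpM2l//.
rewrite ltr_pdivlMr// mulrC in uK.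
have := (hd g).2 _ ud; rewrite distrC; have := ler_norm (h g - h u); lra.
Qed.

End Density.

(** * The functional calculus *)

Section FunctionalCalculus.
Context (R : realType) (X : banachLatticeType R) (m : nat) (x : 'I_m -> X).

Definition lcomb (v : 'rV[R]_m) : X := \sum_(k < m) v ord0 k *: x k.

Lemma lcomb_linear : linear lcomb.
Proof.
move=> a u v; rewrite /lcomb scaler_sumr -big_split/=; apply: eq_bigr => k _.
by rewrite !mxE scalerDl scalerA.
Qed.

Lemma lcomb_delta k : lcomb (delta_mx ord0 k) = x k.
Proof.
rewrite /lcomb (bigD1 k)//= mxE !eqxx scale1r big1 ?addr0// => i ik.
by rewrite mxE (negPf ik) andbF scale0r.
Qed.

Lemma lcomb_bounded v : `|lcomb v| <= (\sum_(k < m) `|x k|) * `|v|.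
Proof.
apply: le_trans (ler_norm_sum _ _ _) _; rewrite mulr_suml; apply: ler_sum => k _.
by rewrite normrZ mulrC ler_wpM2l// coord_le_norm.
Qed.

Definition xeval (t : lterm 'rV[R]_m) : X := leval (@Order.join _ X) lcomb t.

Lemma xeval_ge0 t : (forall s, 0 <= lfun t s) -> 0 <= xeval t.
Proof.
move=> t0; apply: leval_ge0 lcomb_linear lcomb_bounded _ => f [fL _].
suff -> : f = dotv (\row_k f (delta_mx ord0 k)) by exact: t0.
apply/funext => v; rewrite /dotv [in LHS](row_sum_delta v).
elim/big_ind2 : _ => [|u a w b <- <-|k _]; first exact: (linear_fun0 (Y := R^o) fL).
  exact: (linear_funD (Y := R^o) fL).
by rewrite mxE (linear_funZ (Y := R^o) fL).
Qed.

Definition xnorm : R := `|xeval (tnorm R m)|.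

Lemma xeval_dist e t u : 0 <= e ->
    (forall s, `|lfun t s - lfun u s| <= e * `|s|) ->
  `|xeval t - xeval u| <= xnorm * e.
Proof.
move=> e0 tu; rewrite /xnorm mulrC -[X in X * _](ger0_norm e0) -normrZ.
apply: le_norm_modulus; rewrite modulus_le -!(bl_subr_ge0 (e *: _)).
have aux v w : (forall s, `|lfun v s - lfun w s| <= e * `|s|) ->
    0 <= e *: xeval (tnorm R m) - (xeval v - xeval w).
  move=> vw; pose D := LAdd (LScale e (tnorm R m))
     (LScale (-1) (LAdd v (LScale (-1) w))).
  have -> : e *: xeval (tnorm R m) - (xeval v - xeval w) = xeval D.
    by rewrite /D /xeval /= !scaleN1r.
  apply: xeval_ge0 => s; rewrite lfunD !lfunZ lfunD lfunZ lfun_norm.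
  by have := vw s; have := ler_norm (lfun v s - lfun w s); lra.
by rewrite aux//= opprB aux// => s; rewrite distrC.
Qed.

(** The sign condition on [e] matters for [m = 0], where [|s| = 0]. *)
Definition near_fun (e : R) (h g : 'rV[R]_m -> R) :=
  0 <= e /\ forall s, `|h s - g s| <= e * `|s|.

Lemma ler_dist_max (a b c d : R) :
  `|Num.max a b - Num.max c d| <= `|a - c| + `|b - d|.
Proof.
have h1 := ler_norm (a - c); have h2 := ler_norm (c - a).
have h3 := ler_norm (b - d); have h4 := ler_norm (d - b).
move: h2 h4; rewrite (distrC c) (distrC d) => h2 h4.
have h5 := normr_ge0 (a - c); have h6 := normr_ge0 (b - d).
by rewrite ler_norml; have [ab|ab] := leP a b; have [cd|cd] := leP c d; lra.
Qed.

(** The functional calculus is the extension by density of the evaluation of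
    lattice expressions, which is monotone by [xeval_ge0]. *)
Lemma functional_calculus_exists : exists Phi, is_functional_calculus x Phi.
Proof.
pose Y : lmodType R := ('rV[R]_m -> R^o)%type.
pose jY (f g : Y) : Y := fun s => Num.max (f s : R) (g s).
pose G (h : Y) (y : X) := exists2 t, h = lfun t & y = xeval t.
have [|e h g [e0 hg]|e e' f g h [e0 fg] [e'0 gh]|a e e' h g h' g' [e0 hg] [e'0 hg']|
   e e' h g h' g' [e0 hg] [e'0 hg']|
   a _ _ _ _ [t -> ->] [u -> ->]|_ _ _ _ [t -> ->] [u -> ->]|
   e _ _ _ _ [t -> ->] [u -> ->] [e0 tu]|Phi [PhiG Philin Phijoin]] :=
   @dense_extension R X Y jY near_fun G xnorm.
- exact: normr_ge0.
- by split=> // s; rewrite distrC.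
- split=> [|s]; first exact: addr_ge0.
  by rewrite mulrDl; apply: le_trans (ler_distD (g s) _ _) (lerD _ _).
- split=> [|s]; first by rewrite addr_ge0// mulr_ge0.
  have -> : (a *: h + h') s - (a *: g + g') s = a * (h s - g s) + (h' s - g' s).
    rewrite /= mulrBr; have -> : (a *: h + h') s = a * h s + h' s by [].
    have -> : (a *: g + g') s = a * g s + g' s by [].
    by rewrite opprD addrACA.
  apply: le_trans (ler_normD _ _) _; rewrite mulrDl lerD//.
  by rewrite normrM -mulrA ler_wpM2l.
- split=> [|s]; first exact: addr_ge0.
  by rewrite mulrDl; apply: le_trans (ler_dist_max _ _ _ _) (lerD _ _).
- by exists (LAdd (LScale a t) u).
- by exists (LJoin t u).
- exact: xeval_dist.
have ap h : poshom_continuous h -> approximable near_fun G h.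
  move=> hP e e0; have [t ht] := lfun_dense hP e0.
  by exists (lfun t), (xeval t); split; [exists t|split=> //; exact: ltW].
have Philfun t : Phi (lfun t) = xeval t.
  apply/eqP; rewrite -subr_eq0 -normr_le0.
  have := PhiG _ (ap _ (poshom_lfun t)) 0 (lfun t) (xeval t).
  rewrite mulr0; apply; first by exists t.
  by split=> // s; rewrite subrr normr0 mul0r.
have Phi0 : Phi (fun=> 0 : R) = 0.
  have := Philfun (LVar 0); rewrite /xeval /= (linear_fun0 lcomb_linear) => <-.
  by congr Phi; apply/funext => s; rewrite /lfun /= (linear_fun0 (@dotv_linear _ _ s)).
have PhiN h : poshom_continuous h -> Phi (fun s => - h s) = - Phi h.
  move=> hP; have := Philin (-1) h (fun=> 0 : R) (ap _ hP) (ap _ (poshom_cst0 _ _)).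
  by rewrite Phi0 !addr0 !scaleN1r => <-.
have poshomN (h : 'rV[R]_m -> R) : poshom_continuous h ->
    poshom_continuous (fun s => - h s).
  move=> hP; have := poshom_lin (-1) hP (poshom_cst0 _ _).
  by congr poshom_continuous; apply/funext => s; rewrite addr0 mulN1r.
exists Phi; split=> [a h g hP gP|h g hP gP|h g hP gP|k].
- by rewrite -Philin//; exact: ap.
- rewrite bl_meetE -!PhiN// -Phijoin; [|exact/ap/poshomN..].
  rewrite -PhiN; last by apply: poshom_max; exact: poshomN.
  by congr Phi; apply/funext => s; rewrite /jY oppr_max !opprK.
- by rewrite -Phijoin//; exact: ap.
- have := Philfun (tvar R k); rewrite /xeval/= lcomb_delta => <-.
  by congr Phi; apply/funext => s; rewrite lfun_var.
Qed.

Section Uniqueness.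
Variable Phi : ('rV[R]_m -> R) -> X.
Hypothesis PhiP : is_functional_calculus x Phi.

Lemma fc_zero : Phi (fun=> 0) = 0.
Proof.
case: PhiP => lin _ _ _; have := lin (-1) _ _ (poshom_cst0 R m) (poshom_cst0 R m).
rewrite scaleN1r addNr => <-; congr Phi; apply/funext => s; by rewrite mulr0 addr0.
Qed.

Lemma fc_lfun t : Phi (lfun t) = xeval t.
Proof.
case: (PhiP) => lin _ joi coo; elim: t => [v|s IHs t IHt|a t IHt|s IHs t IHt].
- rewrite /lfun /= /dotv /xeval /= /lcomb; elim: (index_enum _) => [|k r IHr].
    by under eq_fun do rewrite big_nil; rewrite big_nil fc_zero.
  under eq_fun do rewrite big_cons; rewrite big_cons -IHr lin ?coo//.
    exact: poshom_coord.
  elim: r {IHr} => [|j r IHr].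
    by under eq_fun do rewrite big_nil; exact: poshom_cst0.
  by under eq_fun do rewrite big_cons; apply: poshom_lin => //; exact: poshom_coord.
- rewrite /xeval /= -/(xeval s) -/(xeval t) -IHs -IHt -[X in X + _]scale1r -lin;
    try exact: poshom_lfun.
  by congr Phi; apply/funext => y; rewrite lfunD mul1r.
- rewrite /xeval /= -/(xeval t) -IHt -[X in _ = X]addr0 -fc_zero -lin;
    [|exact: poshom_lfun|exact: poshom_cst0].
  by congr Phi; apply/funext => y; rewrite lfunZ addr0.
- rewrite /xeval /= -/(xeval s) -/(xeval t) -IHs -IHt -joi//;
    exact: poshom_lfun.
Qed.

Lemma fc_le h g : poshom_continuous h -> poshom_continuous g ->
  (forall s, h s <= g s) -> Phi h <= Phi g.
Proof.
case: PhiP => _ _ joi _ hP gP hg.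
have -> : Phi g = Order.join (Phi h) (Phi g).
  by rewrite -joi//; congr Phi; apply/funext => s; rewrite max_r.
exact: leUl.
Qed.

(** Monotonicity of [Phi] gives [|Phi h - Phi g| <= e Phi(|.|)] from
    [|h - g| <= e |.|]. *)
Lemma fc_near h e t : poshom_continuous h -> 0 <= e ->
  (forall s, `|h s - lfun t s| <= e * `|s|) -> `|Phi h - xeval t| <= xnorm * e.
Proof.
case: (PhiP) => lin _ _ _ hP e0 ht.
rewrite /xnorm mulrC -[X in X * _](ger0_norm e0) -normrZ.
have tP := poshom_lfun t.
have Et : e *: xeval (tnorm R m) + xeval t = Phi (fun s => e * `|s| + lfun t s).
  rewrite lin//; last exact: poshom_norm.
  rewrite fc_lfun -(fc_lfun (tnorm R m)); congr (e *: Phi _ + _).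
  by apply/funext => s; rewrite lfun_norm.
have Eh : e *: xeval (tnorm R m) + Phi h = Phi (fun s => e * `|s| + h s).
  rewrite lin//; last exact: poshom_norm.
  rewrite -(fc_lfun (tnorm R m)); congr (e *: Phi _ + _).
  by apply/funext => s; rewrite lfun_norm.
apply: le_norm_modulus; rewrite modulus_le opprB !blBlDr Et Eh -fc_lfun.
apply/andP; split; apply: fc_le => //; try by apply: poshom_lin => //; exact: poshom_norm.
  by move=> s; have := ht s; have := ler_norm (h s - lfun t s); lra.
by move=> s; have := ht s; have := ler_norm (- (h s - lfun t s)); rewrite normrN; lra.
Qed.

End Uniqueness.

Lemma functional_calculus_near h e t : poshom_continuous h -> 0 <= e ->
    (forall s, `|h s - lfun t s| <= e * `|s|) ->
  `|functional_calculus x h - xeval t| <= xnorm * e.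
Proof.
move=> hP e0 ht; rewrite /functional_calculus.
have [Phi PhiP] := functional_calculus_exists.
case: xgetP => [_ _ [Phi' Phi'P ->]|/(_ (Phi h))]; first exact: fc_near.
by case; exists Phi.
Qed.

End FunctionalCalculus.

(** * Finite p-sums *)

Section PNorm.
Context (R : realType) (p : \bar R).

Definition pnorm (s : seq R) : R :=
  match p with
  | r%:E => (\sum_(u <- s) `|u| `^ r) `^ r^-1
  | _ => \big[Num.max/0]_(u <- s) `|u|
  end.

Lemma pnorm_ge0 s : 0 <= pnorm s.
Proof.
rewrite /pnorm; case: p => [r||]; [exact: powR_ge0|exact: bigmax_ge_id..].
Qed.

Hypothesis hp : (1 <= p)%E.

Lemma pnorm_cases : p = +oo%E \/ exists2 r : R, 1 <= r & p = r%:E.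
Proof.
by case: p hp => [r||] // r1; [right; exists r; rewrite -?lee_fin|left].
Qed.

Lemma pnorm_oo_le c s : p = +oo%E -> 0 <= c ->
  (pnorm s <= c) = all (fun u => `|u| <= c) s.
Proof.
move=> pE c0; rewrite /pnorm pE; elim: s => [|u s IHs]; first by rewrite big_nil.
by rewrite big_cons ge_max IHs.
Qed.

Lemma pnorm_oo_ge s u : p = +oo%E -> u \in s -> `|u| <= pnorm s.
Proof.
move=> pE; have := lexx (pnorm s); rewrite {1}pnorm_oo_le ?pnorm_ge0//.
by move=> /allP h /h.
Qed.

Lemma pnorm_powE (r : R) s : p = r%:E ->
  pnorm s = (\sum_(u <- s) `|u| `^ r) `^ r^-1.
Proof. by move=> pE; rewrite /pnorm pE. Qed.

Lemma sum_powR_ge0 (r : R) (s : seq R) : 0 <= \sum_(u <- s) `|u| `^ r.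
Proof. by rewrite sumr_ge0// => i _; exact: powR_ge0. Qed.

Lemma pnormK (r : R) (s : seq R) : 1 <= r -> p = r%:E ->
  pnorm s `^ r = \sum_(u <- s) `|u| `^ r.
Proof.
move=> r1 pE; rewrite (pnorm_powE _ pE) -powRrM mulVf ?gt_eqF ?(lt_le_trans ltr01)//.
by rewrite powRr1// sum_powR_ge0.
Qed.

Lemma pnorm1 u : pnorm [:: u] = `|u|.
Proof.
have [pE|[r r1 pE]] := pnorm_cases.
  by rewrite /pnorm pE big_cons big_nil max_l.
rewrite (pnorm_powE _ pE) big_seq1.
by rewrite -powRrM mulfV ?powRr1// gt_eqF// (lt_le_trans ltr01).
Qed.

Lemma pnorm_le_map (I : eqType) (r : seq I) (f g : I -> R) :
  (forall i, i \in r -> `|f i| <= `|g i|) ->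
  pnorm (map f r) <= pnorm (map g r).
Proof.
move=> fg; have [pE|[q q1 pE]] := pnorm_cases.
  rewrite pnorm_oo_le ?pnorm_ge0// all_map; apply/allP => i ir /=.
  by apply: le_trans (fg i ir) (pnorm_oo_ge pE _); exact: map_f.
have q0 : 0 < q by rewrite (lt_le_trans ltr01).
rewrite !(pnorm_powE _ pE); apply: ge0_ler_powR; rewrite ?invr_ge0 ?(ltW q0)//.
- by rewrite nnegrE sum_powR_ge0.
- by rewrite nnegrE sum_powR_ge0.
rewrite !big_map !big_seq; apply: ler_sum => i ir.
by apply: ge0_ler_powR; rewrite ?nnegrE// ?(ltW q0)//; exact: fg.
Qed.

Lemma pnormZ c s : pnorm [seq c * u | u <- s] = `|c| * pnorm s.
Proof.
have [pE|[q q1 pE]] := pnorm_cases.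
  apply/le_anti/andP; split.
    rewrite pnorm_oo_le ?mulr_ge0 ?pnorm_ge0// all_map; apply/allP => u us /=.
    by rewrite normrM ler_wpM2l// pnorm_oo_ge.
  have [->|c0] := eqVneq c 0; first by rewrite normr0 mul0r pnorm_ge0.
  have cp : 0 < `|c| by rewrite normr_gt0.
  rewrite mulrC -ler_pdivlMr// pnorm_oo_le ?divr_ge0 ?pnorm_ge0//.
  apply/allP => u us; rewrite ler_pdivlMr// mulrC -normrM pnorm_oo_ge//.
  exact: map_f.
have q0 : 0 < q by rewrite (lt_le_trans ltr01).
rewrite !(pnorm_powE _ pE) !big_map; under eq_bigr do rewrite normrM powRM//.
rewrite -mulr_sumr powRM ?powR_ge0 ?sum_powR_ge0//.
by rewrite -powRrM mulfV ?gt_eqF// powRr1.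
Qed.

Lemma pnorm_flatten ss : pnorm (flatten ss) = pnorm (map pnorm ss).
Proof.
have [pE|[q q1 pE]] := pnorm_cases.
  apply/le_anti/andP; split; rewrite pnorm_oo_le ?pnorm_ge0//.
    apply/allP => u /flattenP[s sss us]; apply: le_trans (pnorm_oo_ge pE us) _.
    apply: le_trans (ler_norm _) (pnorm_oo_ge pE _); exact: map_f.
  rewrite all_map; apply/allP => s sss /=.
  rewrite ger0_norm ?pnorm_ge0// pnorm_oo_le ?pnorm_ge0//; apply/allP => u us.
  by apply: pnorm_oo_ge => //; apply/flattenP; exists s.
rewrite !(pnorm_powE _ pE) big_map big_flatten; congr (_ `^ _).
by apply: eq_bigr => s _; rewrite ger0_norm ?pnorm_ge0// pnormK.
Qed.

Lemma pnorm_ge s u : u \in s -> `|u| <= pnorm s.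
Proof.
move=> us; rewrite -pnorm1 -[X in pnorm X]map_id.
have [pE|[q q1 pE]] := pnorm_cases; first by rewrite map_id pnorm1 pnorm_oo_ge.
have q0 : 0 < q by rewrite (lt_le_trans ltr01).
rewrite !(pnorm_powE _ pE); apply: ge0_ler_powR; rewrite ?invr_ge0 ?(ltW q0)//.
- by rewrite nnegrE sum_powR_ge0.
- by rewrite nnegrE sum_powR_ge0.
by rewrite map_id big_seq1 (big_rem u)//= lerDl sum_powR_ge0.
Qed.

Lemma pnorm_pairs (I : Type) (r : seq I) (f g : I -> R) :
  pnorm [seq pnorm [:: f i; g i] | i <- r] = pnorm [:: pnorm (map f r); pnorm (map g r)].
Proof.
have [pE|[q q1 pE]] := pnorm_cases.
  rewrite /pnorm pE !big_map !big_cons big_nil.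
  rewrite !ger0_norm; [|exact: bigmax_ge_id..].
  elim: r => [|i r IHr]; first by rewrite !big_nil !maxxx.
  rewrite !big_cons IHr big_nil ger0_norm; last by rewrite le_max normr_ge0.
  by rewrite maxACA [X in Num.max _ X]maxACA maxxx.
rewrite (pnorm_powE _ pE) [RHS](pnorm_powE _ pE) big_cons big_seq1 big_map.
rewrite !ger0_norm ?pnorm_ge0// !(pnormK _ q1 pE) !big_map -big_split/=.
congr (_ `^ _); apply: eq_bigr => i _.
by rewrite ger0_norm ?pnorm_ge0// (pnormK _ q1 pE) big_cons big_seq1.
Qed.

(** Convexity of [u |-> u ^ p]: convex combinations are dominated by weighted
    p-sums. *)
Lemma pnorm_conv t : 0 <= t <= 1 -> exists a b : R,
  [/\ 0 <= a, 0 <= b, pnorm [:: a; b] <= 1 &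
    forall u v, 0 <= u -> 0 <= v -> t * u + (1 - t) * v <= pnorm [:: a * u; b * v]].
Proof.
move=> /andP[t0 t1]; have t1' : 0 <= 1 - t by rewrite subr_ge0.
have [pE|[q q1 pE]] := pnorm_cases.
  exists 1, 1; split=> // [|u v u0 v0].
    by rewrite pnorm_oo_le//= normr1 lexx.
  have hu : `|u| <= pnorm [:: 1 * u; 1 * v].
    by apply: pnorm_oo_ge => //; rewrite !mul1r mem_head.
  have hv : `|v| <= pnorm [:: 1 * u; 1 * v].
    by apply: pnorm_oo_ge => //; rewrite !mul1r !inE eqxx orbT.
  rewrite !ger0_norm// in hu hv; have := ler_wpM2l t0 hu; have := ler_wpM2l t1' hv; lra.
have q0 : 0 < q by rewrite (lt_le_trans ltr01).
have qV x : 0 <= x -> (x `^ q^-1) `^ q = x.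
  by move=> x0; rewrite -powRrM mulVf ?gt_eqF// powRr1.
exists (t `^ q^-1), ((1 - t) `^ q^-1); split; rewrite ?powR_ge0//.
  rewrite (pnorm_powE _ pE) big_cons big_seq1 !ger0_norm ?powR_ge0//.
  by rewrite !qV// addrC subrK powR1.
move=> u v u0 v0; rewrite (pnorm_powE _ pE) big_cons big_seq1 !normrM.
rewrite !(ger0_norm (powR_ge0 _ _)) !powRM ?powR_ge0// !qV// !ger0_norm//.
have := @convex_powR R q q1 (Itv01 t0 t1) u v.
rewrite !inE/= !in_itv/= !andbT => /(_ u0 v0); rewrite !convRE/= => h.
have {}h : (t * u + (1 - t) * v) `^ q <= t * u `^ q + (1 - t) * v `^ q by exact: h.
have s0 : 0 <= t * u + (1 - t) * v by rewrite addr_ge0// mulr_ge0.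
rewrite -[leLHS](powRr1 s0) -[X in _ `^ X <= _](mulfV (lt0r_neq0 q0)) powRrM.
apply: ge0_ler_powR => //; rewrite ?invr_ge0 ?(ltW q0)// ?nnegrE ?powR_ge0//.
by rewrite addr_ge0// mulr_ge0 ?powR_ge0.
Qed.

(** Minkowski's inequality, deduced from [pnorm_conv]. *)
Lemma pnormD (I : eqType) (r : seq I) (f g : I -> R) :
  pnorm [seq f i + g i | i <- r] <= pnorm (map f r) + pnorm (map g r).
Proof.
set A := pnorm (map f r); set B := pnorm (map g r).
apply/ler_addgt0Pr => e e0; have A0 : 0 <= A by exact: pnorm_ge0.
have B0 : 0 <= B by exact: pnorm_ge0.
pose A' := A + e / 2; pose B' := B + e / 2; pose S := A' + B'.
have A'0 : 0 < A' by rewrite ltr_wpDl// divr_gt0.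
have B'0 : 0 < B' by rewrite ltr_wpDl// divr_gt0.
have S0 : 0 < S by rewrite addr_gt0.
have [|a [b [a0 b0 ab1 ab]]] := @pnorm_conv (A' / S).
  by rewrite divr_ge0 ?(ltW A'0) ?(ltW S0)//= ler_pdivrMr// mul1r lerDl ltW.
have -> : A + B + e = `|S| * 1 by rewrite gtr0_norm// /S /A' /B'; lra.
suff : pnorm [seq S^-1 * u | u <- [seq f i + g i | i <- r]] <= 1.
  by rewrite pnormZ normfV -ler_pdivlMl ?invrK ?invr_gt0 ?normr_gt0 ?gt_eqF// mulrC.
rewrite -map_comp.
apply: (@le_trans _ _ (pnorm [seq pnorm [:: a / A' * f i; b / B' * g i] | i <- r])).
  apply: pnorm_le_map => i _ /=; rewrite [leRHS]ger0_norm ?pnorm_ge0//.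
  have := ab (`|f i| / A') (`|g i| / B').
  rewrite !divr_ge0 ?(ltW A'0) ?(ltW B'0)// => /(_ isT isT).
  have -> : A' / S * (`|f i| / A') + (1 - A' / S) * (`|g i| / B') =
      S^-1 * (`|f i| + `|g i|).
    rewrite /S; field; rewrite !gt_eqF//=; exact: addr_gt0.
  move=> h; apply: (@le_trans _ _ (S^-1 * (`|f i| + `|g i|))).
    rewrite normrM gtr0_norm ?invr_gt0// ler_wpM2l ?invr_ge0 ?(ltW S0)//.
    exact: ler_normD.
  apply: le_trans h _.
  have := @pnorm_le_map bool [:: true; false]
    (fun c => if c then a * (`|f i| / A') else b * (`|g i| / B'))
    (fun c => if c then a / A' * f i else b / B' * g i).
  apply=> -[] _; rewrite !normrM ?normr_id mulrA mulrAC.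
    by rewrite mulrAC.
  by rewrite mulrAC.
rewrite (pnorm_pairs r (fun i => a / A' * f i) (fun i => b / B' * g i)).
have -> : [seq a / A' * f i | i <- r] = [seq (a / A') * u | u <- map f r].
  by rewrite -map_comp.
have -> : [seq b / B' * g i | i <- r] = [seq (b / B') * u | u <- map g r].
  by rewrite -map_comp.
rewrite !pnormZ; apply: le_trans _ ab1.
have := @pnorm_le_map bool [:: true; false]
    (fun c => if c then `|a / A'| * A else `|b / B'| * B)
    (fun c => if c then a else b).
apply=> -[] _; rewrite normrM normr_id normrM -mulrA ler_piMr// normfV mulrC.
  by rewrite ler_pdivrMr ?normr_gt0 ?gt_eqF// mul1r !ger0_norm ?(ltW A'0)//
    lerDl ltW// divr_gt0.
by rewrite ler_pdivrMr ?normr_gt0 ?gt_eqF// mul1r !ger0_norm ?(ltW B'0)//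
    lerDl ltW// divr_gt0.
Qed.

End PNorm.

(** * p-convexity *)

Section ConvexWith.
Context (R : realType) (p : \bar R).
Hypothesis hp : (1 <= p)%E.

Definition pnorm_row m (s : 'rV[R]_m) : R :=
  pnorm p [seq s ord0 k | k <- index_enum 'I_m].

(** By Minkowski's inequality, [N] is Lipschitz for the maximum norm. *)
Lemma poshom_pnorm m : poshom_continuous (@pnorm_row m).
Proof.
split=> [x|t s t0]; last first.
  rewrite /pnorm_row -[t in RHS]ger0_norm// -pnormZ// -map_comp.
  by congr (pnorm _ _); apply: eq_map => k /=; rewrite mxE.
pose K := pnorm p [seq 1 : R | k <- index_enum 'I_m].
have K0 : 0 <= K by exact: pnorm_ge0.
have lip (s s' : 'rV[R]_m) : pnorm_row s - pnorm_row s' <= K * `|s - s'|.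
  rewrite lerBlDr; apply: (@le_trans _ _ (pnorm_row (s - s') + pnorm_row s')).
    rewrite /pnorm_row; apply: le_trans (pnormD hp _ _ _).
    by rewrite le_eqVlt; apply/orP; left; apply/eqP; congr (pnorm _ _);
      apply: eq_map => k; rewrite !mxE subrK.
  rewrite lerD2r /pnorm_row /K mulrC -[`|s - s'|]normr_id -pnormZ// -map_comp.
  apply: pnorm_le_map => // k _ /=.
  by rewrite mulr1 normr_id; exact: coord_le_norm.
apply: (proj2 (@cvgrPdist_le _ _ _ (nbhs x) (nbhs_filter x) _ _)) => e e0.
apply/nbhs_ballP; exists (e / (K + 1)).
  by rewrite /= divr_gt0// ltr_wpDl.
move=> y; rewrite -ball_normE /ball_/= => /ltW.
rewrite ler_pdivlMr ?ltr_wpDl// => xy.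
have l1 := lip x y; have l2 := lip y x; rewrite (distrC y x) in l2.
have n0 := normr_ge0 (x - y).
by rewrite ler_norml; nra.
Qed.

Lemma pnorm_row_oo m (s : 'rV[R]_m) : p = +oo%E -> pnorm_row s = `|s|.
Proof.
move=> pE; apply/le_anti/andP; split.
  rewrite /pnorm_row pnorm_oo_le//; apply/allP => _ /mapP[k _ ->].
  exact: coord_le_norm.
rewrite [leLHS]mx_normrE; apply: bigmax_le => [|[i k] _] /=; first exact: pnorm_ge0.
by rewrite (ord1 i); apply: pnorm_oo_ge => //; apply: map_f; exact: mem_index_enum.
Qed.

Variable X : banachLatticeType R.

Lemma xeval_tnorm m (x : 'I_m -> X) :
  xeval x (tnorm R m) = \big[Order.join/0]_(k < m) modulus (x k).
Proof.
rewrite /tnorm /tnorm_of; elim: (index_enum _) => [|k r IHr].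
  by rewrite big_nil /xeval /= (linear_fun0 (lcomb_linear x)).
by rewrite big_cons -IHr /xeval /= lcomb_delta scaleN1r.
Qed.

Lemma fc_norm m (x : 'I_m -> X) :
  functional_calculus x (fun s => `|s|) = \big[Order.join/0]_(k < m) modulus (x k).
Proof.
rewrite -xeval_tnorm; apply/eqP; rewrite -subr_eq0 -normr_le0.
rewrite -(mulr0 (xnorm x)); apply: functional_calculus_near => [||s].
- exact: poshom_norm.
- exact: lexx.
- by rewrite lfun_norm subrr normr0 mul0r.
Qed.

(** This treats all [p] alike: at the maximum norm the functional calculus is the
    finite join of the moduli. *)
Lemma convex_withE (M : R) : convex_with p X M <->
  forall (m : nat) (x : 'I_m -> X), `|functional_calculus x (@pnorm_row m)|
    <= M * pnorm p [seq `|x k| | k <- index_enum 'I_m].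
Proof.
have [pE|[r r1 pE]] := pnorm_cases hp.
  have E m (x : 'I_m -> X) : functional_calculus x (@pnorm_row m) =
      \big[Order.join/0]_(k < m) modulus (x k).
    rewrite -fc_norm; congr (functional_calculus _ _).
    by apply/funext => s; rewrite pnorm_row_oo.
  have E' m (x : 'I_m -> X) : pnorm p [seq `|x k| | k <- index_enum 'I_m] =
      \big[Num.max/0]_(k < m) `|x k|.
    by rewrite /pnorm pE big_map; apply: eq_bigr => k _; rewrite normr_id.
  by rewrite /convex_with {1}pE; split=> h m x; have := h m x; rewrite E E'.
have E m (x : 'I_m -> X) : functional_calculus x (@pnorm_row m) =
    functional_calculus x (fun s => (\sum_(k < m) `|s ord0 k| `^ r) `^ r^-1).
  congr (functional_calculus _ _); apply/funext => s.
  by rewrite /pnorm_row /pnorm pE big_map.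
have E' m (x : 'I_m -> X) : pnorm p [seq `|x k| | k <- index_enum 'I_m] =
    (\sum_(k < m) `|x k| `^ r) `^ r^-1.
  rewrite /pnorm pE big_map; congr (_ `^ _); apply: eq_bigr => k _.
  by rewrite normr_id.
by rewrite /convex_with {1}pE; split=> h m x; have := h m x; rewrite E E'.
Qed.

Lemma convexity_constant_ge1 : p_convex p X -> 1 <= convexity_constant p X.
Proof. by move=> Xp; apply: lb_le_inf => // M []. Qed.

(** For each finite family the inequality is closed in [M], so that it passes to
    the infimum. *)
Lemma convex_with_constant : p_convex p X ->
  convex_with p X (convexity_constant p X).
Proof.
move=> Xp; apply/convex_withE => m x.
set N := pnorm p _; have [N0|N0] := eqVneq N 0.
  case: Xp => M [_ /convex_withE/(_ m x)]; by rewrite -/N N0 !mulr0.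
have Np : 0 < N by rewrite lt_neqAle eq_sym N0 pnorm_ge0.
rewrite -ler_pdivrMr//; apply: lb_le_inf => // M [_ /convex_withE/(_ m x)].
by rewrite ler_pdivrMr.
Qed.

End ConvexWith.

(** * The free norm *)

Section FreeNorm.
Context (R : realType) (p : \bar R) (E : normedModType R).
Hypothesis hp : (1 <= p)%E.

(** Only functionals of norm at most 1 are used: dominations are positively
    homogeneous in the functional. *)
Definition dual_ball := {f : E -> R | unit_functional f}.
Implicit Types (f g : dual_ball -> R) (d : dual_ball) (xs ys : seq E).

Definition norms xs : R := pnorm p [seq `|v| | v <- xs].

Definition dominated f xs :=
  forall d, `|f d| <= pnorm p [seq sval d v | v <- xs].

(** A p-convex lattice norm with constant 1 that is at most [|x|] at [delta_x] is at
    most [N(|x_1|, ..., |x_n|)] at [N(delta_x_1, ..., delta_x_n)]; this is the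
    largest lattice norm allowed by that constraint. *)
Definition free_norm f : R := inf [set norms xs | xs in dominated f].

Definition finite_norm f := exists xs, dominated f xs.

Lemma free_norm_le f xs : dominated f xs -> free_norm f <= norms xs.
Proof.
move=> fxs; apply: ge_inf; last by exists xs.
by exists 0 => _ [ys _ <-]; exact: pnorm_ge0.
Qed.

Lemma le_free_norm f b : finite_norm f ->
  (forall xs, dominated f xs -> b <= norms xs) -> b <= free_norm f.
Proof.
move=> [xs fxs] h; apply: lb_le_inf; first by exists (norms xs); exists xs.
by move=> _ [ys fys <-]; exact: h.
Qed.

Lemma free_norm_adherent f c : finite_norm f -> free_norm f < c ->
  exists2 xs, dominated f xs & norms xs < c.
Proof.
move=> ff fc; apply: contrapT => /forall2NP h.
suff : c <= free_norm f by rewrite leNgt fc.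
apply: le_free_norm => // xs fxs; have [//|/negP] := h xs.
by rewrite -leNgt.
Qed.

Lemma free_norm_ge0 f : finite_norm f -> 0 <= free_norm f.
Proof. by move=> ff; apply: le_free_norm => // xs _; exact: pnorm_ge0. Qed.

Lemma dominated_solid f g xs : dominated g xs -> (forall d, `|f d| <= `|g d|) ->
  dominated f xs.
Proof. by move=> gxs fg d; apply: le_trans (fg d) (gxs d). Qed.

Lemma sval_scale d (c : R) xs :
  [seq sval d v | v <- [seq c *: v | v <- xs]] =
  [seq c * u | u <- [seq sval d v | v <- xs]].
Proof.
rewrite -!map_comp; apply: eq_map => v /=.
by rewrite (linear_funZ (Y := R^o) (proj1 (svalP d))).
Qed.

Lemma dominatedZ f (c : R) xs : dominated f xs ->
  dominated (fun d => c * f d) [seq c *: v | v <- xs].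
Proof.
move=> fxs d; rewrite sval_scale pnormZ// normrM; exact: ler_wpM2l.
Qed.

Lemma normsZ (c : R) xs : norms [seq c *: v | v <- xs] = `|c| * norms xs.
Proof.
rewrite /norms -map_comp -[in RHS](normr_id c) -pnormZ// -map_comp.
by congr (pnorm _ _); apply: eq_map => v /=; rewrite normrZ.
Qed.

Lemma norms_flatten xss : norms (flatten xss) = pnorm p (map norms xss).
Proof. by rewrite /norms map_flatten pnorm_flatten// -!map_comp. Qed.

Lemma sval_flatten d xss : pnorm p [seq sval d v | v <- flatten xss] =
  pnorm p [seq pnorm p [seq sval d v | v <- xs] | xs <- xss].
Proof. by rewrite map_flatten pnorm_flatten// -!map_comp. Qed.

(** Convexity of the unit ball: the weights [a, b] of [pnorm_conv] are put on the
    two dominating families, which are then concatenated. *)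
Lemma dominated_conv f g xs ys t : 0 <= t <= 1 ->
    dominated f xs -> dominated g ys -> norms xs <= 1 -> norms ys <= 1 ->
  exists2 zs, dominated (fun d => t * f d + (1 - t) * g d) zs & norms zs <= 1.
Proof.
move=> t01 fxs gys x1 y1; have [a [b [a0 b0 ab1 ab]]] := pnorm_conv hp t01.
move: t01 => /andP[t0 t1]; have t1' : 0 <= 1 - t by rewrite subr_ge0.
pose zs := flatten [:: [seq a *: v | v <- xs]; [seq b *: v | v <- ys]].
exists zs => [d|].
  rewrite sval_flatten /= !sval_scale !pnormZ// !(ger0_norm a0, ger0_norm b0).
  apply: le_trans (ab _ _ (pnorm_ge0 _ _) (pnorm_ge0 _ _)).
  apply: le_trans (ler_normD _ _) _; rewrite !normrM (ger0_norm t0) (ger0_norm t1').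
  by rewrite lerD// ler_wpM2l.
rewrite norms_flatten /= !normsZ !ger0_norm//; apply: le_trans _ ab1.
have := @pnorm_le_map _ _ hp bool [:: true; false]
    (fun c => if c then a * norms xs else b * norms ys)
    (fun c => if c then a else b).
by apply=> -[] _; rewrite normrM ler_piMr// ger0_norm// pnorm_ge0.
Qed.

Lemma dominated_sum f g xs ys (A B : R) : 0 < A -> 0 < B ->
    dominated f xs -> dominated g ys -> norms xs <= A -> norms ys <= B ->
  exists2 zs, dominated (fun d => f d + g d) zs & norms zs <= A + B.
Proof.
move=> A0 B0 fxs gys xA yB; have S0 : 0 < A + B by rewrite addr_gt0.
have [||||| zs hzs z1] := @dominated_conv (fun d => A^-1 * f d)
  (fun d => B^-1 * g d) [seq A^-1 *: v | v <- xs] [seq B^-1 *: v | v <- ys]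
  (A / (A + B)).
- by rewrite divr_ge0 ?(ltW A0) ?(ltW S0)//= ler_pdivrMr// mul1r lerDl ltW.
- exact: dominatedZ.
- exact: dominatedZ.
- by rewrite normsZ gtr0_norm ?invr_gt0// mulrC ler_pdivrMr// mul1r.
- by rewrite normsZ gtr0_norm ?invr_gt0// mulrC ler_pdivrMr// mul1r.
exists [seq (A + B) *: v | v <- zs]; last first.
  by rewrite normsZ gtr0_norm// ler_piMr// ltW.
move=> d; have := dominatedZ (A + B) hzs d; congr (`|_| <= _).
by field; rewrite !gt_eqF.
Qed.

Lemma finite_normD f g : finite_norm f -> finite_norm g ->
  finite_norm (fun d => f d + g d).
Proof.
move=> [xs fxs] [ys gys]; have [|||| zs hz _] :=
   @dominated_sum f g xs ys (norms xs + 1) (norms ys + 1) _ _ fxs gys.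
- by rewrite ltr_wpDl// pnorm_ge0.
- by rewrite ltr_wpDl// pnorm_ge0.
- by rewrite lerDl.
- by rewrite lerDl.
by exists zs.
Qed.

Lemma free_normD f g : finite_norm f -> finite_norm g ->
  free_norm (fun d => f d + g d) <= free_norm f + free_norm g.
Proof.
move=> ff gf; apply/ler_addgt0Pr => e e0; have e2 : 0 < e / 2 by rewrite divr_gt0.
have f0 := free_norm_ge0 ff; have g0 := free_norm_ge0 gf.
have [|xs fxs xn] := @free_norm_adherent f (free_norm f + e / 2) ff.
  by rewrite ltrDl.
have [|ys gys yn] := @free_norm_adherent g (free_norm g + e / 2) gf.
  by rewrite ltrDl.
have [||zs hz zn] := dominated_sum _ _ fxs gys (ltW xn) (ltW yn).
- by rewrite ltr_wpDl.
- by rewrite ltr_wpDl.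
by apply: le_trans (free_norm_le hz) _; apply: le_trans zn _; lra.
Qed.

Lemma finite_normZ f (c : R) : finite_norm f -> finite_norm (fun d => c * f d).
Proof. by move=> [xs fxs]; exists [seq c *: v | v <- xs]; exact: dominatedZ. Qed.

Lemma free_normZ_le f (c : R) : finite_norm f ->
  free_norm (fun d => c * f d) <= `|c| * free_norm f.
Proof.
move=> ff; have [->|c0] := eqVneq c 0.
  rewrite normr0 mul0r; apply: le_trans (free_norm_le (xs := [::]) _) _.
    by move=> d; rewrite mul0r normr0 pnorm_ge0.
  rewrite /norms -[[seq _ | _ <- _]](_ : [seq 0 * u | u <- [::]] = _)//.
  by rewrite pnormZ// normr0 mul0r.
have cp : 0 < `|c| by rewrite normr_gt0.
rewrite mulrC -ler_pdivrMr//; apply: le_free_norm => // xs fxs.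
by rewrite ler_pdivrMr// mulrC -normsZ; apply: free_norm_le; exact: dominatedZ.
Qed.

Lemma free_normZ f (c : R) : finite_norm f ->
  free_norm (fun d => c * f d) = `|c| * free_norm f.
Proof.
move=> ff; apply/le_anti; rewrite free_normZ_le//=.
have [->|c0] := eqVneq c 0.
  by rewrite normr0 mul0r free_norm_ge0//; exact: finite_normZ.
rewrite mulrC -ler_pdivlMr ?normr_gt0// mulrC -normfV.
apply: le_trans (free_normZ_le _ (finite_normZ c ff)).
rewrite le_eqVlt; apply/orP; left; apply/eqP; congr free_norm.
by apply/funext => d; rewrite mulrA mulVf// mul1r.
Qed.

Lemma finite_norm_solid f g : finite_norm g -> (forall d, `|f d| <= `|g d|) ->
  finite_norm f.
Proof. by move=> [xs gxs] fg; exists xs; exact: dominated_solid gxs fg. Qed.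

Lemma free_norm_solid f g : finite_norm g -> (forall d, `|f d| <= `|g d|) ->
  free_norm f <= free_norm g.
Proof.
move=> gf fg; apply: le_free_norm => // xs gxs.
by apply: free_norm_le; exact: dominated_solid gxs fg.
Qed.

Definition delta (v : E) : dual_ball -> R := fun d => sval d v.

Lemma dominated_delta v : dominated (delta v) [:: v].
Proof. by move=> d; rewrite pnorm1. Qed.

Lemma free_norm_delta v : free_norm (delta v) = `|v|.
Proof.
apply/le_anti/andP; split.
  apply: le_trans (free_norm_le (dominated_delta v)) _.
  by rewrite /norms pnorm1// normr_id.
apply: le_free_norm => [|xs h]; first by exists [:: v]; exact: dominated_delta.
have [f uf fv] := norming_functional v.
have := h (exist _ f uf); rewrite /delta /= fv normr_id => /le_trans; apply.
by apply: pnorm_le_map => // w _; rewrite normr_id unit_functional_norm.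
Qed.

(** p-convexity with constant 1 holds because dominations can be substituted in
    one another: the p-sum of p-sums is the p-sum of the concatenation. *)
Lemma free_norm_pnorm (I : eqType) (r : seq I) (f : I -> dual_ball -> R) g :
    (forall i, finite_norm (f i)) ->
    (forall d, `|g d| <= pnorm p [seq f i d | i <- r]) ->
  free_norm g <= pnorm p [seq free_norm (f i) | i <- r].
Proof.
move=> ff gf; apply/ler_addgt0Pr => e e0; pose K := pnorm p [seq 1 : R | i <- r].
have K0 : 0 <= K by exact: pnorm_ge0.
have e1 : 0 < e / (K + 1) by rewrite divr_gt0// ltr_wpDl.
have /choice[xs hxs] : forall i, exists xs, dominated (f i) xs /\
    norms xs <= free_norm (f i) + e / (K + 1).
  move=> i; have [|xs fxs xn] :=
    @free_norm_adherent (f i) (free_norm (f i) + e / (K + 1)) (ff i).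
    by rewrite ltrDl.
  by exists xs; split=> //; exact: ltW.
have gd : dominated g (flatten [seq xs i | i <- r]).
  move=> d; rewrite sval_flatten -map_comp; apply: le_trans (gf d) _.
  apply: pnorm_le_map => // i _ /=; rewrite [leRHS]ger0_norm ?pnorm_ge0//.
  exact: (hxs i).1.
apply: le_trans (free_norm_le gd) _; rewrite norms_flatten -map_comp.
apply: (@le_trans _ _ (pnorm p [seq free_norm (f i) + e / (K + 1) | i <- r])).
  apply: pnorm_le_map => // i _ /=; rewrite !ger0_norm ?pnorm_ge0 ?(hxs i).2//.
  by rewrite addr_ge0 ?free_norm_ge0// ltW.
apply: le_trans (pnormD hp _ _ _) _; rewrite lerD2l.
have -> : [seq e / (K + 1) | i <- r] = [seq e / (K + 1) * u | u <- [seq 1 : R | i <- r]].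
  by rewrite -map_comp; apply: eq_map => i /=; rewrite mulr1.
rewrite pnormZ// gtr0_norm// -/K mulrAC ler_pdivrMr ?ltr_wpDl//.
by rewrite ler_wpM2l ?(ltW e0)//; lra.
Qed.

End FreeNorm.

Section Substitution.
Context (R : realType) (V W : lmodType R) (phi : V -> W).

Fixpoint lterm_map (t : lterm V) : lterm W :=
  match t with
  | LVar v => LVar (phi v)
  | LAdd s t => LAdd (lterm_map s) (lterm_map t)
  | LScale a t => LScale a (lterm_map t)
  | LJoin s t => LJoin (lterm_map s) (lterm_map t)
  end.

Lemma leval_map (Y : lmodType R) (j : Y -> Y -> Y) (T : W -> Y) t :
  leval j T (lterm_map t) = leval j (T \o phi) t.
Proof. by elim: t => //= [s -> t ->|a t ->|s -> t ->]. Qed.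

End Substitution.

Section FreeLattice.
Context (R : realType) (p : \bar R) (E : normedModType R).
Hypothesis hp : (1 <= p)%E.

Definition efun (t : lterm E) (d : dual_ball E) : R :=
  leval (Y := R^o) Num.max (sval d) t.

Lemma finite_norm_efun t : finite_norm p (efun t).
Proof.
elim: t => [v|s IHs t IHt|a t IHt|s IHs t IHt].
- by exists [:: v]; exact: dominated_delta.
- exact: finite_normD.
- exact: finite_normZ.
- have fa u : finite_norm p (efun u) -> finite_norm p (fun d => `|efun u d|).
    by move=> /finite_norm_solid; apply => d; rewrite normr_id.
  apply: finite_norm_solid (finite_normD hp (fa _ IHs) (fa _ IHt)) _ => d.
  rewrite [leRHS]ger0_norm ?addr_ge0//.
  have := ler_dist_max (efun s d) (efun t d) 0 0; rewrite maxxx !subr0; exact.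
Qed.

Context (X : banachLatticeType R).

(** The estimate behind the universal property.  If [|f| <= N(delta_x)], then
    applying the lattice homomorphism that extends [T] should give
    [|T^ f| <= N(T x)], whose norm is at most [M N(|T x|)].  Since [N(delta_x)] is
    not a lattice expression, [N] is first approximated by one, up to a small
    multiple of the maximum norm. *)
Lemma leval_free_norm (T : E -> X) (C M : R) t : linear T -> 0 <= C -> 0 <= M ->
    (forall v, `|T v| <= C * `|v|) -> convex_with p X M ->
  `|leval (@Order.join _ X) T t| <= M * C * free_norm p (efun t).
Proof.
move=> TL C0 M0 TC XM.
suff h xs : dominated p (efun t) xs ->
    `|leval (@Order.join _ X) T t| <= M * C * norms p xs.
  have [MC|MC] := eqVneq (M * C) 0.
    by have [xs /h] := finite_norm_efun t; rewrite MC !mul0r.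
  have MCp : 0 < M * C by rewrite lt_neqAle eq_sym MC mulr_ge0.
  rewrite mulrC -ler_pdivrMr//; apply: le_free_norm; first exact: finite_norm_efun.
  by move=> xs /h; rewrite ler_pdivrMr// mulrC.
move=> fxs; pose m := size xs; pose x (k : 'I_m) := T (nth 0 xs k).
pose phi (v : 'rV[R]_m) : E := \sum_(k < m) v ord0 k *: nth 0 xs k.
have xsE (Z : Type) (f : E -> Z) :
    [seq f v | v <- xs] = [seq f (nth 0 xs (nat_of_ord k)) | k <- index_enum 'I_m].
  rewrite -[in LHS](mkseq_nth 0 xs) /mkseq -val_enum_ord -!map_comp.
  by rewrite /index_enum -enumT.
have Tphi : T \o phi = lcomb x.
  apply/funext => v; rewrite /= /phi /lcomb.
  elim/big_ind2 : _ => [|u y w z <- <-|k _]; [exact: linear_fun0|exact: linear_funD|].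
  exact: linear_funZ.
have dphi (d : dual_ball E) : sval d \o phi = dotv (\row_k sval d (nth 0 xs k)).
  apply/funext => v; rewrite /= /phi /dotv.
  have dL := (proj1 (svalP d)).
  elim/big_ind2 : _ => [|u y w z <- <-|k _].
  - exact: (linear_fun0 (Y := R^o) dL).
  - exact: (linear_funD (Y := R^o) dL).
  - by rewrite (linear_funZ (Y := R^o) dL) mxE.
have efun_phi u d : efun (lterm_map phi u) d = lfun u (\row_k sval d (nth 0 xs k)).
  by rewrite /efun leval_map dphi.
have leval_phi u : leval (@Order.join _ X) T (lterm_map phi u) = xeval x u.
  by rewrite leval_map Tphi.
set y := functional_calculus x (@pnorm_row R p m).
have yM : `|y| <= M * C * norms p xs.
  apply: le_trans (proj1 (convex_withE hp X M) XM m x) _.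
  rewrite -mulrA ler_wpM2l// -[C in leRHS]ger0_norm// -pnormZ// xsE -map_comp.
  apply: pnorm_le_map => // k _ /=; rewrite normr_id ger0_norm ?mulr_ge0//.
  exact: TC.
apply: le_trans yM; apply/ler_addgt0Pr => e e0.
pose K := xnorm x; have K0 : 0 <= K by exact: normr_ge0.
pose e' := e / (2 * (K + 1)).
have e'0 : 0 < e' by rewrite divr_gt0// mulr_gt0// ltr_wpDl.
have [u hu] := lfun_dense (poshom_pnorm hp m) e'0.
pose U := LAdd (lterm_map phi u) (LScale e' (lterm_map phi (tnorm R m))).
have levU : leval (@Order.join _ X) T U = xeval x u + e' *: xeval x (tnorm R m).
  by rewrite /= !leval_phi.
have tU d : `|efun t d| <= efun U d.
  apply: le_trans (fxs d) _.
  have -> : efun U d = efun (lterm_map phi u) d +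
      e' * efun (lterm_map phi (tnorm R m)) d by [].
  rewrite !efun_phi lfun_norm; set s := \row__ _.
  have -> : pnorm p [seq sval d v | v <- xs] = pnorm_row p s.
    rewrite /pnorm_row xsE; congr (pnorm _ _); apply: eq_map => k.
    by rewrite mxE.
  by have := hu s; have := ler_norm (pnorm_row p s - lfun u s); lra.
have pos v : (forall d, 0 <= efun v d) -> 0 <= leval (@Order.join _ X) T v.
  by move=> v0; apply: leval_ge0 TL TC _ => f uf; exact: (v0 (exist _ f uf)).
have : `|leval (@Order.join _ X) T t| <= `|leval (@Order.join _ X) T U|.
  apply: le_norm_modulus; rewrite modulus_le -!(bl_subr_ge0 (leval _ _ U)).
  apply/andP; split.
    have -> : leval (@Order.join _ X) T U - leval (@Order.join _ X) T t =
      leval (@Order.join _ X) T (LAdd U (LScale (-1) t)) by rewrite /= scaleN1r.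
    apply: pos => d.
    have -> : efun (LAdd U (LScale (-1) t)) d = efun U d + -1 * efun t d by [].
    by have := tU d; have := ler_norm (efun t d); lra.
  have -> : leval (@Order.join _ X) T U - - leval (@Order.join _ X) T t =
    leval (@Order.join _ X) T (LAdd U t) by rewrite /= opprK.
  apply: pos => d; have -> : efun (LAdd U t) d = efun U d + efun t d by [].
  by have := tU d; have := ler_norm (- efun t d); rewrite normrN; lra.
move=> /le_trans; apply; rewrite levU; apply: le_trans (ler_normD _ _) _.
rewrite normrZ gtr0_norm// -/(xnorm x) -/K.
have := functional_calculus_near x (poshom_pnorm hp m) (ltW e'0) hu.
rewrite -/y -/K => hy.
have hx : `|xeval x u| <= `|y| + K * e'.
  apply: le_trans (lerD (lexx _) hy); rewrite -{1}(subrK y (xeval x u)) addrC.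
  by apply: le_trans (ler_normD _ _) _; rewrite (distrC y).
apply: le_trans (lerD hx (lexx _)) _; rewrite -addrA lerD2l.
have -> : K * e' + e' * K = e * (K / (K + 1)).
  by rewrite /e'; field; rewrite gt_eqF// ltr_wpDl.
rewrite ler_piMr ?(ltW e0)// ler_pdivrMr ?ltr_wpDl//; lra.
Qed.

End FreeLattice.

(** * Completion of a lattice of functions *)

(** A vector lattice of real functions with a lattice seminorm.  As its elements are
    functions with the pointwise operations, the vector lattice identities needed
    for its completion are inherited from the reals. *)
Record function_lattice (R : realType) := FunctionLattice {
  fl_dom : Type;
  fl_mem : set (fl_dom -> R^o);
  fl_norm : (fl_dom -> R^o) -> R;
  fl_mem0 : fl_mem 0;
  fl_memL : forall (a : R) f g, fl_mem f -> fl_mem g -> fl_mem (a *: f + g);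
  fl_memJ : forall f g, fl_mem f -> fl_mem g ->
    fl_mem (fun d => Num.max (f d : R) (g d));
  fl_normD : forall f g, fl_mem f -> fl_mem g ->
    fl_norm (f + g) <= fl_norm f + fl_norm g;
  fl_normZ : forall (a : R) f, fl_mem f -> fl_norm (a *: f) = `|a| * fl_norm f;
  fl_solid : forall f g, fl_mem f -> fl_mem g ->
    (forall d, `|f d| <= `|g d|) -> fl_norm f <= fl_norm g }.

Section Completion.
Context (R : realType) (B : function_lattice R).
Local Notation D := (fl_dom B).
Local Notation L := (@fl_mem R B).
Local Notation nu := (@fl_norm R B).
Local Notation fn := (D -> R^o).

Lemma fl_memD f g : L f -> L g -> L (f + g).
Proof. by move=> Lf Lg; have := fl_memL 1 Lf Lg; rewrite scale1r. Qed.
Lemma fl_memZ (a : R) f : L f -> L (a *: f).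
Proof. by move=> Lf; have := fl_memL a Lf (fl_mem0 B); rewrite addr0. Qed.
Lemma fl_memN f : L f -> L (- f).
Proof. by move=> Lf; have := fl_memZ (-1) Lf; rewrite scaleN1r. Qed.
Lemma fl_memB f g : L f -> L g -> L (f - g).
Proof. by move=> Lf Lg; apply: fl_memD Lf (fl_memN Lg). Qed.

Lemma fl_normN f : L f -> nu (- f) = nu f.
Proof. by move=> Lf; rewrite -scaleN1r fl_normZ// normrN1 mul1r. Qed.

Lemma fl_norm0 : nu 0 = 0.
Proof. by rewrite -(scale0r 0) fl_normZ ?normr0 ?mul0r//; exact: fl_mem0. Qed.

Lemma fl_norm_ge0 f : L f -> 0 <= nu f.
Proof.
move=> Lf; rewrite -fl_norm0; apply: fl_solid => //; first exact: fl_mem0.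
by move=> d; rewrite normr0.
Qed.

Lemma fl_dist_norm f g : L f -> L g -> `|nu f - nu g| <= nu (f - g).
Proof.
move=> Lf Lg; have aux u v : L u -> L v -> nu u - nu v <= nu (u - v).
  move=> Lu Lv; rewrite lerBlDr -[u in leLHS](subrK v); apply: fl_normD => //.
  exact: fl_memB.
rewrite ler_norml aux// andbT lerNl opprB; apply: le_trans (aux _ _ Lg Lf) _.
by rewrite -opprB fl_normN//; exact: fl_memB.
Qed.

Definition fjoin (f g : fn) : fn := fun d => Num.max (f d : R) (g d).

Lemma fl_joinB f g f' g' : L f -> L g -> L f' -> L g' ->
  nu (fjoin f g - fjoin f' g') <= nu (f - f') + nu (g - g').
Proof.
move=> Lf Lg Lf' Lg'.
have abs h : L h -> L (fun d => `|h d| : R) /\ nu (fun d => `|h d| : R) <= nu h.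
  move=> Lh; have La : L (fun d => `|h d| : R).
    have := fl_memJ Lh (fl_memN Lh); congr L; apply/funext => d.
    rewrite -[X in Num.max _ X]/(- (h d : R)).
    have [a0|a0] := leP 0 (h d : R); first by rewrite ger0_norm// max_l//; lra.
    by rewrite ltr0_norm// max_r//; lra.
  by split=> //; apply: fl_solid => // d; rewrite normr_id.
have [La na] := abs _ (fl_memB Lf Lf'); have [Lb nb] := abs _ (fl_memB Lg Lg').
apply: le_trans (lerD na nb); apply: le_trans (fl_normD La Lb).
apply: fl_solid; [exact: fl_memB (fl_memJ _ _) (fl_memJ _ _)|exact: fl_memD|].
move=> d; rewrite [leRHS]ger0_norm; last by rewrite addr_ge0.
exact: ler_dist_max.
Qed.

Definition fcauchy (u : nat -> fn) := (forall n, L (u n)) /\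
  forall e : R, 0 < e -> exists N, forall n m,
    (N <= n)%N -> (N <= m)%N -> nu (u n - u m) <= e.

Definition cauchy_pred : {pred (nat -> fn)} := fun u => `[< fcauchy u >].

Lemma fcauchy_const f : L f -> fcauchy (fun=> f).
Proof.
move=> Lf; split=> // e e0; exists 0%N => n m _ _.
by rewrite subrr fl_norm0 ltW.
Qed.

Lemma fcauchy_lin (a : R) u v : fcauchy u -> fcauchy v -> fcauchy (a *: u + v).
Proof.
move=> [Lu uC] [Lv vC]; split=> [n|e e0]; first exact: fl_memL.
have a0 : 0 < 2 * (`|a| + 1) by rewrite mulr_gt0// ltr_wpDl.
have [N uN] := uC _ (divr_gt0 e0 a0); have [M vM] := vC _ (divr_gt0 e0 (ltr0n R 2)).
exists (maxn N M) => n m; rewrite !geq_max => /andP[Nn Mn] /andP[Nm Mm].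
have -> : (a *: u + v) n - (a *: u + v) m = a *: (u n - u m) + (v n - v m).
  by rewrite scalerBr addrACA -opprD.
have Lun := fl_memB (Lu n) (Lu m); have Lvn := fl_memB (Lv n) (Lv m).
apply: le_trans (fl_normD (fl_memZ _ Lun) Lvn) _; rewrite fl_normZ//.
rewrite [leRHS]splitr lerD// ?vM//.
apply: (@le_trans _ _ (`|a| * (e / (2 * (`|a| + 1))))); first by rewrite ler_wpM2l// uN.
apply: (@le_trans _ _ ((`|a| + 1) * (e / (2 * (`|a| + 1))))).
  by rewrite ler_wpM2r ?divr_ge0 ?(ltW e0) ?(ltW a0)//; lra.
rewrite le_eqVlt; apply/orP; left; apply/eqP; field.
by rewrite gt_eqF// ltr_wpDl.
Qed.

Lemma fcauchy_join u v : fcauchy u -> fcauchy v ->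
  fcauchy (fun n => fjoin (u n) (v n)).
Proof.
move=> [Lu uC] [Lv vC]; split=> [n|e e0]; first exact: fl_memJ.
have [N uN] := uC _ (divr_gt0 e0 (ltr0n R 2)).
have [M vM] := vC _ (divr_gt0 e0 (ltr0n R 2)).
exists (maxn N M) => n m; rewrite !geq_max => /andP[Nn Mn] /andP[Nm Mm].
apply: le_trans (fl_joinB (Lu n) (Lv n) (Lu m) (Lv m)) _.
by rewrite [e]splitr lerD// ?uN ?vM.
Qed.

Lemma cauchy_pred_submod : submod_closed cauchy_pred.
Proof.
split=> [|a u v]; first by apply/asboolP/fcauchy_const; exact: fl_mem0.
by rewrite !unfold_in => /asboolP uC /asboolP vC; apply/asboolP; exact: fcauchy_lin.
Qed.

HB.instance Definition _ := GRing.isSubmodClosed.Build R _ cauchy_pred cauchy_pred_submod.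

Record cauchy_seq := CauchySeq {
  cauchy_val :> nat -> fn; cauchy_valP : cauchy_val \in cauchy_pred }.

HB.instance Definition _ := [isSub for cauchy_val].
HB.instance Definition _ := [Choice of cauchy_seq by <:].
HB.instance Definition _ := [SubChoice_isSubLmodule of cauchy_seq by <:].

Local Notation S := cauchy_seq.

Lemma cauchy_seqP (u : S) : fcauchy u.
Proof. by have /asboolP := cauchy_valP u. Qed.

Lemma cauchy_mem (u : S) n : L (u n).
Proof. exact: (cauchy_seqP u).1. Qed.

Definition mk_cauchy (u : nat -> fn) (uC : fcauchy u) : S :=
  CauchySeq (introT (asboolP _) uC).

Definition is_cnorm (u : S) (l : R) :=
  forall e : R, 0 < e -> exists N, forall n, (N <= n)%N -> `|nu (u n) - l| <= e.

Lemma is_cnorm_ex u : exists l, is_cnorm u l.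
Proof.
apply: (@cauchy_seq_cvg R R^o (fun n => nu (u n))) => e e0.
have [N uN] := (cauchy_seqP u).2 e e0; exists N => n m Nn Nm.
apply: le_trans (uN n m Nn Nm); apply: fl_dist_norm; exact: cauchy_mem.
Qed.

Definition cnorm (u : S) : R := xget 0 (is_cnorm u).

Lemma cnormP u : is_cnorm u (cnorm u).
Proof.
rewrite /cnorm; case: xgetP => [l -> //|].
by have [l hl] := is_cnorm_ex u => /(_ l).
Qed.

(** The only passage to the limit in the norm: the other inequalities between
    norms of sequences are instances of this one. *)
Lemma cnorm_le (u v w : S) (a : R) :
  (forall n, nu (u n) <= a * nu (v n) + nu (w n)) ->
  cnorm u <= a * cnorm v + cnorm w.
Proof.
move=> h; apply/ler_addgt0Pr => e e0.
have e3 : 0 < e / (3 * (`|a| + 1)) by rewrite divr_gt0// mulr_gt0// ltr_wpDl.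
have e3' : 0 < e / 3 by rewrite divr_gt0.
have [N1 h1] := cnormP u e3'; have [N2 h2] := cnormP v e3.
have [N3 h3] := cnormP w e3'; pose n := maxn N1 (maxn N2 N3).
have := h1 n (leq_maxl _ _); have := h2 n; rewrite 2!leq_max leqnn orbT => /(_ isT).
have := h3 n; rewrite 2!leq_max leqnn !orbT => /(_ isT).
rewrite !ler_norml => /andP[w1 w2] hv /andP[u1 u2]; move: hv; rewrite -ler_norml => hv.
have : a * nu (v n) <= a * cnorm v + e / 3.
  rewrite -lerBlDl -mulrBr; apply: le_trans (ler_norm _) _; rewrite normrM.
  apply: (@le_trans _ _ (`|a| * (e / (3 * (`|a| + 1))))); first by rewrite ler_wpM2l.
  apply: (@le_trans _ _ ((`|a| + 1) * (e / (3 * (`|a| + 1))))).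
    by rewrite ler_wpM2r ?(ltW e3)//; lra.
  rewrite le_eqVlt; apply/orP; left; apply/eqP; field.
  by rewrite gt_eqF// ltr_wpDl.
by have := h n; lra.
Qed.

Lemma cnorm0 : cnorm 0 = 0.
Proof.
apply/eqP; rewrite -normr_le0; apply/ler_addgt0Pr => e e0; rewrite add0r.
by have [N /(_ N (leqnn N))] := cnormP 0 e0; rewrite fl_norm0 sub0r normrN.
Qed.

Lemma cnorm_ge0 u : 0 <= cnorm u.
Proof.
have := @cnorm_le 0 0 u 0; rewrite cnorm0 mul0r add0r; apply => n.
by rewrite fl_norm0 mul0r add0r fl_norm_ge0//; exact: cauchy_mem.
Qed.

Lemma cnorm_eq (u v : S) : (forall n, nu (u n) = nu (v n)) -> cnorm u = cnorm v.
Proof.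
move=> uv; apply/le_anti/andP; split.
  by have := @cnorm_le u 0 v 0; rewrite mul0r add0r; apply => n; rewrite mul0r add0r uv.
by have := @cnorm_le v 0 u 0; rewrite mul0r add0r; apply => n; rewrite mul0r add0r uv.
Qed.

Lemma cnormD u v : cnorm (u + v) <= cnorm u + cnorm v.
Proof.
rewrite -[cnorm u]mul1r; apply: cnorm_le => n; rewrite mul1r.
exact: fl_normD (cauchy_mem u n) (cauchy_mem v n).
Qed.

Lemma cnormZ (a : R) u : cnorm (a *: u) = `|a| * cnorm u.
Proof.
apply/le_anti/andP; split.
  rewrite -[leRHS]addr0 -cnorm0; apply: cnorm_le => n.
  by rewrite fl_norm0 addr0 -fl_normZ//; exact: cauchy_mem.
have [->|a0] := eqVneq a 0; first by rewrite normr0 mul0r cnorm_ge0.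
rewrite mulrC -ler_pdivlMr ?normr_gt0// mulrC -[leRHS]addr0 -cnorm0.
apply: cnorm_le => n; rewrite fl_norm0 addr0.
have -> : (a *: u) n = a *: u n by [].
rewrite fl_normZ ?mulrA ?mulVf ?mul1r ?normr_eq0//; exact: cauchy_mem.
Qed.

Lemma cnormN u : cnorm (- u) = cnorm u.
Proof. by rewrite -scaleN1r cnormZ normrN1 mul1r. Qed.

Definition null_pred : {pred S} := fun u => cnorm u == 0.

Lemma null_zmod : zmod_closed null_pred.
Proof.
split=> [|u v]; first by apply/eqP; exact: cnorm0.
rewrite !unfold_in => /eqP u0 /eqP v0; rewrite eq_le cnorm_ge0 andbT.
by apply: le_trans (cnormD _ _) _; rewrite cnormN u0 v0 addr0.
Qed.

HB.instance Definition _ := GRing.isZmodClosed.Build S null_pred null_zmod.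

Definition completion : Type := Quotient.quot null_pred.
HB.instance Definition _ := Choice.on completion.
HB.instance Definition _ := GRing.Zmodule.on completion.

Definition class_of (u : S) : completion := (\pi_(Quotient.quot null_pred) u).
Definition repr_of (q : completion) : S := repr (q : (Quotient.quot null_pred)).

Lemma repr_ofK q : class_of (repr_of q) = q.
Proof. exact: reprK. Qed.

Lemma class_ofP u v : class_of u = class_of v <-> cnorm (u - v) = 0.
Proof.
rewrite /class_of; split=> [/eqP|uv]; last apply/eqP;
  rewrite -Quotient.idealrBE unfold_in; first by move/eqP.
by apply/eqP.
Qed.

Lemma class_ofB u v : class_of (u - v) = class_of u - class_of v.
Proof. exact: (raddfB \pi_(Quotient.quot null_pred)). Qed.

Lemma class_ofD u v : class_of (u + v) = class_of u + class_of v.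
Proof. exact: (raddfD \pi_(Quotient.quot null_pred)). Qed.

Lemma class_ofN u : class_of (- u) = - class_of u.
Proof. exact: (raddfN \pi_(Quotient.quot null_pred)). Qed.

Lemma class_of0 : class_of 0 = 0.
Proof. exact: (raddf0 \pi_(Quotient.quot null_pred)). Qed.

Lemma repr_class u : cnorm (repr_of (class_of u) - u) = 0.
Proof. by apply/class_ofP; exact: repr_ofK. Qed.

Definition cscale (a : R) (q : completion) : completion :=
  class_of (a *: repr_of q).

Lemma cscale_class a u : cscale a (class_of u) = class_of (a *: u).
Proof. by apply/class_ofP; rewrite -scalerBr cnormZ repr_class mulr0. Qed.

Lemma completion_ind (P : completion -> Prop) :
  (forall u, P (class_of u)) -> forall q, P q.
Proof. by move=> h q; rewrite -(repr_ofK q). Qed.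

Lemma cscaleA a b q : cscale a (cscale b q) = cscale (a * b) q.
Proof. by elim/completion_ind: q => u; rewrite !cscale_class scalerA. Qed.
Lemma cscale1 : left_id 1 cscale.
Proof. by elim/completion_ind => u; rewrite cscale_class scale1r. Qed.
Lemma cscaleDr : right_distributive cscale +%R.
Proof.
move=> a; elim/completion_ind => u; elim/completion_ind => v.
by rewrite -class_ofD !cscale_class -class_ofD scalerDr.
Qed.
Lemma cscaleDl q : {morph cscale^~ q : a b / a + b}.
Proof.
by move=> a b; elim/completion_ind: q => u; rewrite !cscale_class -class_ofD scalerDl.
Qed.

HB.instance Definition _ := GRing.Zmodule_isLmodule.Build R completion
  cscaleA cscale1 cscaleDr cscaleDl.

Lemma class_ofZ a u : class_of (a *: u) = a *: class_of u.
Proof. by rewrite -cscale_class. Qed.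

Definition qnorm (q : completion) : R := cnorm (repr_of q).

Lemma qnorm_class u : qnorm (class_of u) = cnorm u.
Proof.
rewrite /qnorm; apply/le_anti/andP; split.
  rewrite -[X in cnorm X <= _](subrK u); apply: le_trans (cnormD _ _) _.
  by rewrite repr_class add0r.
rewrite -[X in cnorm X <= _](subrK (repr_of (class_of u))).
apply: le_trans (cnormD _ _) _.
by rewrite -opprB cnormN repr_class add0r.
Qed.

Lemma qnormD q r : qnorm (q + r) <= qnorm q + qnorm r.
Proof.
elim/completion_ind: q => u; elim/completion_ind: r => v.
by rewrite -class_ofD !qnorm_class cnormD.
Qed.
Lemma qnormZ a q : qnorm (a *: q) = `|a| * qnorm q.
Proof.
by elim/completion_ind: q => u; rewrite -class_ofZ !qnorm_class cnormZ.
Qed.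
Lemma qnorm0_eq0 q : qnorm q = 0 -> q = 0.
Proof.
elim/completion_ind: q => u; rewrite qnorm_class -class_of0 => u0.
by apply/class_ofP; rewrite subr0.
Qed.

HB.instance Definition _ := @Lmodule_isNormed.Build R completion
  qnorm qnormD qnormZ qnorm0_eq0.

Lemma norm_class u : `|class_of u| = cnorm u.
Proof. exact: qnorm_class. Qed.

Definition cjoin (u v : S) : S :=
  mk_cauchy (fcauchy_join (cauchy_seqP u) (cauchy_seqP v)).

Definition qjoin (q r : completion) : completion :=
  class_of (cjoin (repr_of q) (repr_of r)).

Lemma cnorm_cjoinB u v u' v' :
  cnorm (cjoin u v - cjoin u' v') <= cnorm (u - u') + cnorm (v - v').
Proof.
rewrite -[cnorm (u - u')]mul1r; apply: cnorm_le => n; rewrite mul1r.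
exact: fl_joinB (cauchy_mem u n) (cauchy_mem v n) (cauchy_mem u' n) (cauchy_mem v' n).
Qed.

Lemma qjoin_class u v : qjoin (class_of u) (class_of v) = class_of (cjoin u v).
Proof.
apply/class_ofP/le_anti; rewrite cnorm_ge0 andbT.
by apply: le_trans (cnorm_cjoinB _ _ _ _) _; rewrite !repr_class addr0.
Qed.

Lemma cauchy_seq_eq (u v : S) : (forall n d, u n d = v n d) -> u = v.
Proof. by move=> uv; apply: val_inj; apply/funext => n; apply/funext => d; exact: uv. Qed.

Lemma qjoinC : commutative qjoin.
Proof.
elim/completion_ind => u; elim/completion_ind => v; rewrite !qjoin_class.
by congr class_of; apply: cauchy_seq_eq => n d; exact: maxC.
Qed.
Lemma qjoinA : associative qjoin.
Proof.
elim/completion_ind => u; elim/completion_ind => v; elim/completion_ind => w.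
rewrite !qjoin_class.
by congr class_of; apply: cauchy_seq_eq => n d; exact: maxA.
Qed.
Lemma qjoinxx : idempotent_op qjoin.
Proof.
elim/completion_ind => u; rewrite !qjoin_class.
by congr class_of; apply: cauchy_seq_eq => n d; exact: maxxx.
Qed.
Lemma qjoinD z x y : z + qjoin x y = qjoin (z + x) (z + y).
Proof.
elim/completion_ind: x => u; elim/completion_ind: y => v; elim/completion_ind: z => w.
rewrite qjoin_class -!class_ofD qjoin_class; congr class_of.
apply: cauchy_seq_eq => n d.
by have := addr_maxr (w n d : R) (u n d : R) (v n d : R); exact.
Qed.
Lemma qjoinZ (a : R) x y : 0 <= a -> a *: qjoin x y = qjoin (a *: x) (a *: y).
Proof.
move=> a0; elim/completion_ind: x => u; elim/completion_ind: y => v.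
rewrite qjoin_class -!class_ofZ qjoin_class; congr class_of.
apply: cauchy_seq_eq => n d.
by have := maxr_pMr (u n d : R) (v n d : R) a0; exact.
Qed.

Definition qle (x y : completion) : bool := qjoin x y == y.
Definition qmeet (x y : completion) : completion := - qjoin (- x) (- y).

Lemma qle_refl : reflexive qle.
Proof. by move=> x; apply/eqP; exact: qjoinxx. Qed.
Lemma qle_anti : antisymmetric qle.
Proof. by move=> x y /andP[/eqP xy /eqP yx]; rewrite -xy qjoinC. Qed.
Lemma qle_trans : transitive qle.
Proof. by move=> y x z /eqP xy /eqP yz; apply/eqP; rewrite -yz qjoinA xy. Qed.

Lemma qjoinP x y z : qle (qjoin x y) z = qle x z && qle y z.
Proof.
apply/eqP/andP => [h|[/eqP xz /eqP yz]]; last by rewrite -qjoinA yz xz.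
split; apply/eqP; rewrite -h.
  by rewrite !qjoinA qjoinxx.
by rewrite -qjoinA [qjoin x _]qjoinC -!qjoinA qjoinA qjoinxx qjoinC -qjoinA.
Qed.

Lemma qleD2l x y z : qle x y -> qle (z + x) (z + y).
Proof. by move=> /eqP xy; apply/eqP; rewrite -qjoinD xy. Qed.

Lemma qleN x y : qle (- x) (- y) = qle y x.
Proof.
have aux u v : qle u v -> qle (- v) (- u).
  by move=> /(qleD2l (- u - v)); rewrite addrAC addNr add0r subrK.
by apply/idP/idP => /aux; rewrite ?opprK.
Qed.

Lemma qmeetP x y z : qle x (qmeet y z) = qle x y && qle x z.
Proof. by rewrite /qmeet -qleN opprK qjoinP !qleN. Qed.

Lemma qscale_ge0 (a : R) x : 0 <= a -> qle 0 x -> qle 0 (a *: x).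
Proof.
by move=> a0 /eqP x0; apply/eqP; rewrite -{1}(scaler0 _ a) -qjoinZ// x0.
Qed.

Lemma qle_norm x y : qle (qjoin x (- x)) (qjoin y (- y)) -> `|x| <= `|y|.
Proof.
elim/completion_ind: x => u; elim/completion_ind: y => v.
rewrite -(class_ofN u) -(class_ofN v) (qjoin_class u) (qjoin_class v) => /eqP.
rewrite qjoin_class => e.
have modE (w : S) n : nu (cjoin w (- w) n) = nu (w n).
  have wd d : `|cjoin w (- w) n d| = `|w n d|.
    rewrite -[cjoin w (- w) n d]/(Num.max (w n d : R) (- (w n d : R))).
    have [a0|a0] := leP 0 (w n d : R).
      by rewrite max_l//; lra.
    by rewrite max_r ?normrN//; lra.
  have Lw := cauchy_mem w n; have Lc := cauchy_mem (cjoin w (- w)) n.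
  by apply/le_anti/andP; split; apply: fl_solid => // d; rewrite wd.
rewrite !norm_class -(cnorm_eq (modE u)) -(cnorm_eq (modE v)).
rewrite -[leRHS]norm_class -e norm_class -[leRHS]addr0 -cnorm0 -[X in X + _]mul1r.
apply: cnorm_le => n; rewrite fl_norm0 addr0 mul1r.
apply: fl_solid; [exact: cauchy_mem|exact: cauchy_mem|move=> d].
rewrite -[cjoin u _ n d]/(Num.max (u n d : R) (- (u n d : R))).
rewrite -[cjoin (cjoin _ _) _ n d]/(Num.max (Num.max (u n d : R) (- (u n d : R)))
  (Num.max (v n d : R) (- (v n d : R)))).
have m0 : 0 <= Num.max (u n d : R) (- (u n d : R)).
  have [x0|/ltW x0] := leP 0 (u n d : R); first by rewrite le_max x0.
  by rewrite le_max oppr_ge0 x0 orbT.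
have aux (a b : R) : 0 <= a -> `|a| <= `|Num.max a b|.
  move=> a0; apply: (@le_trans _ _ (Num.max a b)); last exact: ler_norm.
  by rewrite ger0_norm// le_max lexx.
exact: aux m0.
Qed.

Definition embed (f : fn) (Lf : L f) : completion :=
  class_of (mk_cauchy (fcauchy_const Lf)).


Lemma embed_lin (a : R) f g (Lf : L f) (Lg : L g) (Lh : L (a *: f + g)) :
  embed Lh = a *: embed Lf + embed Lg.
Proof.
by rewrite /embed -class_ofZ -class_ofD; congr class_of; exact: cauchy_seq_eq.
Qed.

Lemma embed_join f g (Lf : L f) (Lg : L g) (Lh : L (fjoin f g)) :
  embed Lh = qjoin (embed Lf) (embed Lg).
Proof.
by rewrite /embed qjoin_class; congr class_of; exact: cauchy_seq_eq.
Qed.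

Lemma norm_embed f (Lf : L f) : `|embed Lf| = nu f.
Proof.
rewrite norm_class; apply/eqP; rewrite -subr_eq0 -normr_le0; apply/ler_addgt0Pr => e e0.
have [N /(_ N (leqnn N))] := cnormP (mk_cauchy (fcauchy_const Lf)) e0.
by rewrite add0r distrC.
Qed.

(** A Cauchy sequence is the limit of its own terms. *)
Lemma embed_dense (q : completion) (e : R) : 0 < e ->
  exists f (Lf : L f), `|q - embed Lf| <= e.
Proof.
elim/completion_ind: q => u e0; have [N uN] := (cauchy_seqP u).2 _ e0.
exists (u N), (cauchy_mem u N); rewrite /embed -class_ofB norm_class.
apply/ler_addgt0Pr => d d0.
have [M hM] := cnormP (u - mk_cauchy (fcauchy_const (cauchy_mem u N))) d0.
have := hM _ (leq_maxr N M); have := uN _ _ (leq_maxl N M) (leqnn N).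
set w := (u - _ : S) => h1 h2.
have {}h1 : nu (w (maxn N M)) <= e by exact: h1.
have := ler_norm (- (nu (w (maxn N M)) - cnorm w)); rewrite normrN; lra.
Qed.

(** Diagonal argument: replace each [q n] by an embedded function [f n] at distance
    at most [1 / (n + 1)]; these functions form a Cauchy sequence, whose class is
    the limit. *)
Lemma completion_seq_complete (q : nat -> completion) :
    (forall e : R, 0 < e -> exists N, forall n m,
       (N <= n)%N -> (N <= m)%N -> `|q n - q m| <= e) ->
  exists l, forall e : R, 0 < e -> exists N, forall n, (N <= n)%N -> `|q n - l| <= e.
Proof.
move=> qC; have /choice[f hf] : forall n : nat, exists fL : {f | L f},
    `|q n - embed (svalP fL)| <= n.+1%:R^-1.
  move=> n; have [|f [Lf h]] := @embed_dense (q n) n.+1%:R^-1.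
    by rewrite invr_gt0.
  exists (exist _ f Lf); apply: le_trans h; rewrite le_eqVlt; apply/orP; left.
  by apply/eqP; congr (`|_ - _|); rewrite /embed; congr class_of; exact: cauchy_seq_eq.
have nuE n m : nu (sval (f n) - sval (f m)) =
    `|embed (svalP (f n)) - embed (svalP (f m))|.
  rewrite -(norm_embed (fl_memB (svalP (f n)) (svalP (f m)))) /embed -class_ofB.
  by rewrite !norm_class; exact: cnorm_eq.
have wC : fcauchy (fun n => sval (f n)).
  split=> [n|e e0]; first exact: svalP.
  have e3 : 0 < e / 3 by rewrite divr_gt0.
  have [N1 h1] := qC _ e3; have [N2 h2] := archi_inv e3.
  exists (maxn N1 N2) => n m; rewrite !geq_max => /andP[n1 n2] /andP[m1 m2].
  rewrite nuE -(subrKA (q n)); apply: le_trans (ler_normD _ _) _.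
  rewrite -(subrKA (q m) (q n)); apply: le_trans (lerD (lexx _) (ler_normD _ _)) _.
  rewrite distrC; have := h1 _ _ n1 m1; have := le_trans (hf n) (h2 _ n2).
  by have := le_trans (hf m) (h2 _ m2); lra.
exists (class_of (mk_cauchy wC)) => e e0.
have e2 : 0 < e / 2 by rewrite divr_gt0.
have [N1 h1] := wC.2 _ e2; have [N2 h2] := archi_inv e2.
exists (maxn N1 N2) => n; rewrite geq_max => /andP[n1 n2].
rewrite -(subrKA (embed (svalP (f n)))); apply: le_trans (ler_normD _ _) _.
rewrite [leRHS]splitr; apply: lerD; first exact: le_trans (hf n) (h2 _ n2).
rewrite /embed -class_ofB norm_class; apply/ler_addgt0Pr => d d0.
set w := (_ - _ : S); have [M hM] := cnormP w d0.
have := hM _ (leq_maxr N1 M); have := h1 _ _ n1 (leq_maxl N1 M) => h3 h4.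
have {}h3 : nu (w (maxn N1 M)) <= e / 2 by exact: h3.
have := ler_norm (- (nu (w (maxn N1 M)) - cnorm w)); rewrite normrN; lra.
Qed.

End Completion.

(** A Cauchy filter has the same limits as a sequence of centres of balls of radius
    [1 / (n + 1)] that belong to it. *)
Lemma seq_complete_cauchy_cvg (R : realType) (X : normedModType R) :
    (forall u : nat -> X, (forall e : R, 0 < e -> exists N, forall n m,
       (N <= n)%N -> (N <= m)%N -> `|u n - u m| <= e) ->
     exists l : X, forall e : R, 0 < e -> exists N, forall n,
       (N <= n)%N -> `|u n - l| <= e) ->
  forall F : set_system X, ProperFilter F -> cauchy F -> cvg F.
Proof.
move=> Xc F FF /cauchyP FC.
have /choice[x hx] : forall n : nat, exists x, F (ball x (n.+1%:R^-1 : R)).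
  by move=> n; apply: FC; rewrite invr_gt0.
have xx n m : `|x n - x m| <= n.+1%:R^-1 + m.+1%:R^-1.
  have [y []] := filter_ex (filterI (hx n) (hx m)).
  rewrite -!ball_normE /ball_/= => /ltW ny /ltW my.
  rewrite -(subrKA y); apply: le_trans (ler_normD _ _) _.
  by rewrite (distrC y) lerD.
have [|l hl] := Xc x.
  move=> e e0; have [N hN] := archi_inv (divr_gt0 e0 (ltr0n R 2)).
  exists N => n m Nn Nm; apply: le_trans (xx n m) _.
  by rewrite [leRHS]splitr lerD// hN.
apply/cvg_ex; exists l; apply/cvg_ballP => e e0.
have e3 : 0 < e / 3 by rewrite divr_gt0.
have [N hN] := archi_inv e3; have [M hM] := hl _ e3.
pose n := maxn N M; apply: filterS (hx n) => y.
rewrite -!ball_normE /ball_/= => ny.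
have h1 := hN n (leq_maxl _ _); have h2 := hM n (leq_maxr _ _).
rewrite -(subrKA (x n)); apply: le_lt_trans (ler_normD _ _) _.
rewrite (distrC l); apply: (@le_lt_trans _ _ (e / 3 + e / 3)); last by lra.
by apply: lerD => //; apply: le_trans (ltW ny) h1.
Qed.

HB.instance Definition _ (R : realType) (B : function_lattice R) :=
  Uniform_isComplete.Build (completion B)
    (seq_complete_cauchy_cvg (@completion_seq_complete R B)).

HB.instance Definition _ (R : realType) (B : function_lattice R) :=
  CompleteNormedModule_isBanachLattice.Build R (completion B)
    (@qle_refl R B) (@qle_anti R B) (@qle_trans R B) (@qmeetP R B) (@qjoinP R B)
    (@qleD2l R B) (@qscale_ge0 R B) (@qle_norm R B).

(** * Operators and lattice homomorphisms *)

Section OperatorNorm.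
Context (R : realType) (V W : normedModType R).

Lemma opnorm_le (T : V -> W) (C : R) : 0 <= C ->
  (forall x, `|T x| <= C * `|x|) -> (opnorm T <= C%:E)%E.
Proof.
move=> C0 TC; apply: ge_ereal_sup => _ [x /= x1 <-]; rewrite lee_fin.
by apply: le_trans (TC x) _; rewrite ler_piMr.
Qed.

Lemma opnorm_bound (T : {linear V -> W}) (C : R) : (opnorm T <= C%:E)%E ->
  forall x, `|T x| <= C * `|x|.
Proof.
move=> TC x; have [->|x0] := eqVneq x 0; first by rewrite linear0 !normr0 mulr0.
have xp : 0 < `|x| by rewrite normr_gt0.
have : (`|T (`|x|^-1 *: x)|%:E <= C%:E)%E.
  apply: le_trans TC; apply: ereal_sup_ubound; exists (`|x|^-1 *: x) => //=.
  by rewrite normrZ gtr0_norm ?invr_gt0// mulVf// gt_eqF.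
rewrite lee_fin linearZ normrZ gtr0_norm ?invr_gt0//.
by rewrite mulrC ler_pdivrMr.
Qed.

Lemma opnorm_fin (T : {linear V -> W}) : (opnorm T < +oo)%E ->
  exists C : R, [/\ 0 <= C, opnorm T = C%:E & forall x, `|T x| <= C * `|x|].
Proof.
move=> Tfin; have T0 : (0 <= opnorm T)%E.
  apply: ereal_sup_ubound; exists 0; rewrite /= ?normr0 ?ler01//.
  by rewrite linear0 normr0.
have Tf : opnorm T \is a fin_num by rewrite ge0_fin_numE.
exists (fine (opnorm T)); split; [exact: fine_ge0|by rewrite fineK|].
by apply: opnorm_bound; rewrite fineK.
Qed.

End OperatorNorm.

Section LatticeHom.
Context (R : realType) (X Y : banachLatticeType R).

Lemma lattice_hom_join (S : {linear X -> Y}) :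
  {morph S : x y / Order.join x y >-> Order.join x y} -> lattice_hom S.
Proof.
by move=> Sj; split=> x y //; rewrite !bl_meetE linearN Sj !linearN.
Qed.

Lemma lattice_hom_le (S : {linear X -> Y}) x y : lattice_hom S ->
  x <= y -> S x <= S y.
Proof. by move=> [_ Sj] xy; rewrite -(join_r xy) Sj leUl. Qed.

(** Positive operators are continuous.  Otherwise there are [x_n >= 0] with
    [|x_n| <= 2^-n] and [|S x_n| > n], but [S] is finite at [\sum_n x_n]. *)
Lemma lattice_hom_bounded (S : {linear X -> Y}) : lattice_hom S ->
  exists C : R, forall x, `|S x| <= C * `|x|.
Proof.
move=> Sh; apply: contrapT => /forallNP nC.
have /choice[x hx] : forall n : nat, exists x : X,
    [/\ 0 <= x, `|x| <= 2^-1 ^+ n & n%:R < `|S x|].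
  move=> n; have /existsNP[z /negP] := nC (n%:R * 2 ^+ n).
  rewrite -ltNge => hz.
  have z0 : 0 < `|z|.
    rewrite normr_gt0; apply/eqP => z0; move: hz.
    by rewrite z0 linear0 !normr0 mulr0 ltxx.
  have c0 : 0 < 2^-1 ^+ n / `|z| by rewrite divr_gt0// exprn_gt0.
  exists ((2^-1 ^+ n / `|z|) *: modulus z); split.
  - by rewrite -(scaler0 _ (2^-1 ^+ n / `|z|)); apply: blZ (modulus_ge0 z); exact: ltW.
  - by rewrite normrZ gtr0_norm// norm_modulus divfK// gt_eqF.
  - rewrite linearZ/= normrZ gtr0_norm//.
    apply: (@lt_le_trans _ _ (2^-1 ^+ n / `|z| * `|S z|)).
      rewrite mulrAC ltr_pdivlMr//.
      have r1 : 2^-1 ^+ n * 2 ^+ n = 1 :> R by rewrite -exprMn mulVf// expr1n.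
      rewrite [ltLHS](_ : _ = 2^-1 ^+ n * (n%:R * 2 ^+ n * `|z|)).
        by rewrite ltr_pM2l// exprn_gt0.
      rewrite -[LHS]mul1r -[X in X * _ = _]r1; ring.
    rewrite ler_wpM2l ?(ltW c0)//; apply: le_norm_modulus.
    rewrite modulus_le -linearN; apply/andP; split; apply: lattice_hom_le => //.
      exact: le_modulus.
    exact: leN_modulus.
pose s n := \sum_(k < n) x k.
have sB n j : `|s (n + j)%N - s n| <= 2 * 2^-1 ^+ n - 2 * 2^-1 ^+ (n + j).
  elim: j => [|j IHj]; first by rewrite addn0 !subrr normr0.
  rewrite addnS {1}/s big_ord_recr/= -/(s _) addrAC.
  apply: le_trans (ler_normD _ _) _; have [_ h _] := hx (n + j)%N.
  apply: le_trans (lerD IHj h) _; rewrite exprS; lra.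
have sI n j : s n <= s (n + j)%N.
  elim: j => [|j IHj]; first by rewrite addn0.
  rewrite addnS {2}/s big_ord_recr/= -/(s _); apply: le_trans IHj _.
  by rewrite -[leLHS]addr0 blD2l; have [] := hx (n + j)%N.
have p2 (e : R) : 0 < e -> exists N, 2 * 2^-1 ^+ N <= e.
  move=> e0; have [N hN] := archi_inv (divr_gt0 e0 (ltr0n R 2)).
  exists N; rewrite -ler_pdivlMl// mulrC; apply: le_trans (hN N (leqnn N)).
  rewrite exprVn lef_pV2 ?posrE ?exprn_gt0// -natrX ler_nat.
  exact: ltn_expl.
have [|l hl] := @cauchy_seq_cvg R X s.
  move=> e e0; have [N hN] := p2 _ (divr_gt0 e0 (ltr0n R 2)).
  have sN n : (N <= n)%N -> `|s n - s N| <= e / 2.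
    move=> Nn; rewrite -(subnKC Nn); apply: le_trans (sB _ _) _.
    by apply: le_trans hN; rewrite gerBl mulr_ge0// exprn_ge0.
  exists N => n m Nn Nm; rewrite -(subrKA (s N)); apply: le_trans (ler_normD _ _) _.
  by rewrite [leRHS]splitr lerD ?sN// distrC sN.
have xl n : x n <= l.
  apply: bl_le_closed => e e0; have [N hN] := hl e e0.
  exists (s (maxn N n.+1) - l); last exact: hN (leq_maxl _ _).
  rewrite addrC subrK -(subnKC (leq_maxr N n.+1)).
  apply: le_trans (sI n.+1 _); rewrite /s big_ord_recr/= -[leLHS]add0r blD2r.
  have : 0 <= s n by apply: le_trans (sI 0%N n); rewrite /s big_ord0.
  exact.
have Sl n : n%:R < `|S l|.
  have [x0 _ h] := hx n; apply: lt_le_trans h _; apply: bl_ge0_norm.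
    by rewrite -(linear0 S); exact: lattice_hom_le.
  exact: lattice_hom_le.
have Sl0 : 0 < (`|S l| + 1)^-1 by rewrite invr_gt0 ltr_wpDl.
have [N hN] := archi_inv Sl0.
have := hN N (leqnn N); rewrite lef_pV2 ?posrE// ?ltr_wpDl// -natr1 lerD2r.
by rewrite leNgt Sl.
Qed.

End LatticeHom.

(** * The free p-convex Banach lattice *)

Section FreeBanachLattice.
Context (R : realType) (p : \bar R) (E : completeNormedModType R).
Hypothesis hp : (1 <= p)%E.

Definition lattice_functions : set (dual_ball E -> R^o) :=
  [set f | exists t, f = efun t].

Lemma lattice_functions_finite f : lattice_functions f -> finite_norm p f.
Proof. by move=> [t ->]; exact: finite_norm_efun. Qed.

Program Definition free_function_lattice : function_lattice R :=
  @FunctionLattice R (dual_ball E) lattice_functions (@free_norm R p E) _ _ _ _ _ _.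
Next Obligation.
exists (LScale 0 (LVar 0)); apply/funext => d; rewrite /efun /=.
by rewrite scale0r.
Qed.
Next Obligation. by move=> a f g [t ->] [u ->]; exists (LAdd (LScale a t) u). Qed.
Next Obligation. by move=> f g [t ->] [u ->]; exists (LJoin t u). Qed.
Next Obligation.
move=> f g /lattice_functions_finite ff /lattice_functions_finite gf.
exact: free_normD.
Qed.
Next Obligation.
move=> a f /lattice_functions_finite ff; exact: free_normZ.
Qed.
Next Obligation.
move=> f g _ /lattice_functions_finite gf; exact: free_norm_solid.
Qed.

Definition fbl : banachLatticeType R := completion free_function_lattice.

Definition fbl_term (t : lterm E) : fbl :=
  @embed R free_function_lattice (efun t) (ex_intro _ t erefl).


Local Notation lmem := (@fl_mem R free_function_lattice).

Lemma embed_termE t f (Lf : lmem f) : f = efun t -> embed Lf = fbl_term t.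
Proof.
move=> ft; rewrite /fbl_term /embed; congr class_of.
by apply: cauchy_seq_eq => n d /=; rewrite ft.
Qed.

Lemma fbl_term_lin (a : R) t u :
  fbl_term (LAdd (LScale a t) u) = a *: fbl_term t + fbl_term u.
Proof. exact: embed_lin. Qed.

Lemma fbl_term_join t u :
  fbl_term (LJoin t u) = Order.join (fbl_term t) (fbl_term u).
Proof. exact: embed_join. Qed.

Lemma fbl_term_ext t u : efun t = efun u -> fbl_term t = fbl_term u.
Proof. exact: embed_termE. Qed.

Lemma norm_fbl_term t : `|fbl_term t| = free_norm p (efun t).
Proof. exact: norm_embed. Qed.

Lemma fbl_term_dense (q : fbl) (e : R) : 0 < e -> exists t, `|q - fbl_term t| <= e.
Proof.
move=> e0; have [f [Lf h]] := embed_dense q e0; have [t ft] := Lf.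
by exists t; rewrite -(embed_termE Lf ft).
Qed.

Lemma fbl_termD t u : fbl_term (LAdd t u) = fbl_term t + fbl_term u.
Proof.
rewrite -[X in X + _]scale1r -fbl_term_lin; apply: fbl_term_ext.
by apply/funext => d; rewrite /efun /= scale1r.
Qed.

Lemma fbl_term0 : fbl_term (LVar 0) = 0.
Proof.
apply/eqP; rewrite -normr_eq0 norm_fbl_term.
by have := free_norm_delta hp (0 : E); rewrite normr0 => ->.
Qed.

Lemma fbl_termZ (a : R) t : fbl_term (LScale a t) = a *: fbl_term t.
Proof.
rewrite -[RHS]addr0 -fbl_term0 -fbl_term_lin; apply: fbl_term_ext.
apply/funext => d; rewrite /efun /= (linear_fun0 (Y := R^o) (proj1 (svalP d))).
by rewrite addr0.
Qed.

Definition fbl_delta (v : E) : fbl := fbl_term (LVar v).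

Lemma fbl_delta_linear : linear fbl_delta.
Proof.
move=> a u v; rewrite /fbl_delta -fbl_term_lin; apply: fbl_term_ext.
by apply/funext => d; rewrite /efun /= (proj1 (svalP d)).
Qed.

HB.instance Definition _ := GRing.isLinear.Build R E fbl *:%R fbl_delta
  fbl_delta_linear.

Lemma norm_fbl_delta v : `|fbl_delta v| = `|v|.
Proof. by rewrite /fbl_delta norm_fbl_term; exact: free_norm_delta. Qed.

End FreeBanachLattice.

(** * Its p-convexity *)

Section Convexity.
Context (R : realType).

(** The lattice operations are nonexpansive, so each lattice expression is Lipschitz
    in its variables. *)
Lemma xeval_lipschitz (X : banachLatticeType R) m (t : lterm 'rV[R]_m) :
  exists2 K : R, 0 <= K & forall (x x' : 'I_m -> X) (e : R), 0 <= e ->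
    (forall k, `|x k - x' k| <= e) -> `|xeval x t - xeval x' t| <= K * e.
Proof.
elim: t => [v|s [K K0 hK] t [M M0 hM]|a t [K K0 hK]|s [K K0 hK] t [M M0 hM]].
- exists (\sum_(k < m) `|v ord0 k|) => [|x x' e e0 xx]; first exact: sumr_ge0.
  rewrite /xeval /= /lcomb -sumrB; apply: le_trans (ler_norm_sum _ _ _) _.
  rewrite mulr_suml; apply: ler_sum => k _.
  by rewrite -scalerBr normrZ ler_wpM2l.
- exists (K + M) => [|x x' e e0 xx]; first exact: addr_ge0.
  rewrite /xeval /= -/(xeval x s) -/(xeval x t) -/(xeval x' s) -/(xeval x' t).
  rewrite opprD addrACA mulrDl; apply: le_trans (ler_normD _ _) _.
  by rewrite lerD ?hK ?hM.
- exists (`|a| * K) => [|x x' e e0 xx]; first exact: mulr_ge0.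
  rewrite /xeval /= -/(xeval x t) -/(xeval x' t) -scalerBr normrZ -mulrA.
  by rewrite ler_wpM2l// hK.
- exists (K + M) => [|x x' e e0 xx]; first exact: addr_ge0.
  rewrite /xeval /= -/(xeval x s) -/(xeval x t) -/(xeval x' s) -/(xeval x' t).
  by rewrite mulrDl; apply: le_trans (norm_joinB _ _ _ _) _; rewrite lerD ?hK ?hM.
Qed.

Context (p : \bar R) (E : completeNormedModType R).
Hypothesis hp : (1 <= p)%E.
Local Notation F := (fbl E hp).

Section Substitution.
Context (m : nat) (f : 'I_m -> lterm E).

(** Substitution of elements of the free vector lattice over [E] for the
    coordinates of a lattice expression in finitely many variables. *)
Fixpoint tsubst (t : lterm 'rV[R]_m) : lterm E :=
  match t with
  | LVar v => foldr (fun k u => LAdd (LScale (v ord0 k) (f k)) u) (LVar 0)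
                (index_enum 'I_m)
  | LAdd s t => LAdd (tsubst s) (tsubst t)
  | LScale a t => LScale a (tsubst t)
  | LJoin s t => LJoin (tsubst s) (tsubst t)
  end.

Lemma efun_tsubst t d : efun (tsubst t) d = lfun t (\row_k efun (f k) d).
Proof.
elim: t => [v|s IHs t IHt|a t IHt|s IHs t IHt] //=.
- rewrite /lfun /= /dotv; elim: (index_enum _) => [|k r IHr].
    by rewrite big_nil /efun /= (linear_fun0 (Y := R^o) (proj1 (svalP d))).
  by rewrite big_cons -IHr mxE.
- by rewrite lfunD -IHs -IHt.
- by rewrite lfunZ -IHt.
- by rewrite lfunJ -IHs -IHt.
Qed.

Lemma xeval_tsubst t :
  xeval (fun k => fbl_term hp (f k)) t = fbl_term hp (tsubst t).
Proof.
elim: t => [v|s IHs t IHt|a t IHt|s IHs t IHt] /=.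
- rewrite /xeval /= /lcomb; elim: (index_enum _) => [|k r IHr].
    by rewrite big_nil -fbl_term0.
  by rewrite big_cons IHr -fbl_term_lin.
- by rewrite fbl_termD -IHs -IHt.
- by rewrite fbl_termZ -IHt.
- by rewrite fbl_term_join -IHs -IHt.
Qed.

End Substitution.

(** By density the family may be replaced by lattice functions [f_k], and the
    p-sum by a lattice expression in the [f_k], whose norm is controlled by
    [free_norm_pnorm]. *)
Lemma fbl_convex_with1 : convex_with p F 1.
Proof.
apply/(convex_withE hp) => m x; rewrite mul1r.
set y := functional_calculus _ _; set N := pnorm p _.
apply/ler_addgt0Pr => e e0.
pose K1 := pnorm p [seq 1 : R | k <- index_enum 'I_m].
have N0 : 0 <= N by exact: pnorm_ge0.
have K10 : 0 <= K1 by exact: pnorm_ge0.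
pose C := xnorm x; have C0 : 0 <= C by exact: normr_ge0.
pose d := Num.min 1 (e / 2 / (C + N + 1)).
have S0 : 0 < C + N + 1 by rewrite ltr_wpDl// addr_ge0.
have d0 : 0 < d by rewrite lt_min ltr01 !divr_gt0.
have d1 : d <= 1 by rewrite ge_min lexx.
have dC : d * (C + N) <= e / 2.
  apply: (@le_trans _ _ (d * (C + N + 1))).
    by rewrite ler_wpM2l ?(ltW d0)//; lra.
  by rewrite -ler_pdivlMr// ge_min lexx orbT.
have [t ht] := lfun_dense (poshom_pnorm hp m) d0.
have [K K0 hK] := xeval_lipschitz F t.
pose c := e / 2 / (K + 2 * K1 + 1).
have T0 : 0 < K + 2 * K1 + 1 by rewrite ltr_wpDl// addr_ge0// mulr_ge0.
have c0 : 0 < c by rewrite !divr_gt0.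
have cK : (K + 2 * K1) * c <= e / 2.
  apply: (@le_trans _ _ ((K + 2 * K1 + 1) * c)).
    by rewrite ler_wpM2r ?(ltW c0)//; lra.
  by rewrite mulrC /c divfK// gt_eqF.
have /choice[f hf] : forall k, exists t : lterm E, `|x k - fbl_term hp t| <= c.
  by move=> k; exact: fbl_term_dense.
have h1 := functional_calculus_near x (poshom_pnorm hp m) (ltW d0) ht.
have h2 := hK x _ c (ltW c0) hf.
have h3 : `|xeval (fun k => fbl_term hp (f k)) t| <= (1 + d) * (N + K1 * c).
  rewrite xeval_tsubst norm_fbl_term.
  have ff k : finite_norm p (fun b => (1 + d) * efun (f k) b).
    by apply: finite_normZ => //; exact: finite_norm_efun.
  apply: le_trans (free_norm_pnorm hp (r := index_enum 'I_m) ff _) _ => [b|].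
    rewrite efun_tsubst; set s := \row__ _.
    have -> : pnorm p [seq (1 + d) * efun (f k) b | k <- index_enum 'I_m] =
        (1 + d) * pnorm_row p s.
      rewrite -[1 + d in RHS]ger0_norm ?addr_ge0 ?(ltW d0)// -pnormZ// -map_comp.
      by congr (pnorm _ _); apply: eq_map => k; rewrite /= mxE.
    have hs : `|s| <= pnorm_row p s.
      rewrite [leLHS]mx_normrE; apply: bigmax_le => [|[i k] _] /=.
        exact: pnorm_ge0.
      by rewrite (ord1 i); apply: pnorm_ge => //; apply: map_f; exact: mem_index_enum.
    have := ht s; have s0 : 0 <= pnorm_row p s by exact: pnorm_ge0.
    rewrite distrC => hts; have := ler_wpM2l (ltW d0) hs.
    have := ler_normD (lfun t s - pnorm_row p s) (pnorm_row p s).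
    by rewrite subrK (ger0_norm s0); lra.
  apply: (@le_trans _ _ (pnorm p
      [seq (1 + d) * u | u <- [seq `|x k| + c | k <- index_enum 'I_m]])).
    rewrite -map_comp; apply: pnorm_le_map => // k _ /=.
    rewrite free_normZ//; last exact: finite_norm_efun.
    rewrite !normrM normr_id ler_wpM2l// -norm_fbl_term normr_id.
    rewrite [leRHS]ger0_norm ?addr_ge0 ?(ltW c0)//.
    rewrite -[X in `|X| <= _](subrK (x k)) addrC; apply: le_trans (ler_normD _ _) _.
    by rewrite lerD2l distrC.
  rewrite pnormZ// ger0_norm ?addr_ge0 ?(ltW d0)// ler_wpM2l ?addr_ge0 ?(ltW d0)//.
  apply: le_trans (pnormD hp _ _ _) _; rewrite lerD2l.
  have -> : [seq c | k <- index_enum 'I_m] =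
      [seq c * u | u <- [seq 1 : R | k <- index_enum 'I_m]].
    by rewrite -map_comp; apply: eq_map => i /=; rewrite mulr1.
  by rewrite pnormZ// gtr0_norm// mulrC.
have : `|y| <= C * d + K * c + (1 + d) * (N + K1 * c).
  rewrite -(subrK (xeval x t) y); apply: le_trans (ler_normD _ _) _.
  rewrite -addrA; apply: lerD => //.
  rewrite -(subrK (xeval (fun k => fbl_term hp (f k)) t) (xeval x t)).
  by apply: le_trans (ler_normD _ _) _; exact: lerD.
have : d * (K1 * c) <= K1 * c by rewrite ler_piMl// mulr_ge0// ltW.
by move: dC cK; rewrite mulrDr !mulrDl mul1r; lra.
Qed.

Lemma fbl_p_convex : p_convex p F.
Proof. by exists 1; split=> //; exact: fbl_convex_with1. Qed.

Lemma fbl_convexity_constant : convexity_constant p F = 1.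
Proof.
apply/le_anti; rewrite (convexity_constant_ge1 fbl_p_convex) andbT.
apply: ge_inf; first by exists 1 => M [].
by split=> //; exact: fbl_convex_with1.
Qed.

End Convexity.

(** * Its universal property *)

Section UniversalProperty.
Context (R : realType) (p : \bar R) (E : completeNormedModType R).
Hypothesis hp : (1 <= p)%E.
Local Notation F := (fbl E hp).
Context (X : banachLatticeType R).

Lemma lattice_hom_fbl_term (S : {linear F -> X}) t : lattice_hom S ->
  S (fbl_term hp t) = leval (@Order.join _ X) (S \o fbl_delta hp) t.
Proof.
move=> [_ Sj]; elim: t => [v|s IHs t IHt|a t IHt|s IHs t IHt] //=.
- by rewrite fbl_termD linearD IHs IHt.
- by rewrite fbl_termZ linearZ IHt.
- by rewrite fbl_term_join Sj IHs IHt.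
Qed.

(** Two lattice homomorphisms that agree on [E] agree on lattice expressions,
    which are dense, and both are automatically continuous. *)
Lemma lattice_hom_fbl_eq (S S' : {linear F -> X}) : lattice_hom S -> lattice_hom S' ->
  S \o fbl_delta hp =1 S' \o fbl_delta hp -> S =1 S'.
Proof.
move=> Sh S'h SS' q; have [C hC] := lattice_hom_bounded Sh.
have [C' hC'] := lattice_hom_bounded S'h.
apply/eqP; rewrite -subr_eq0 -normr_le0; apply/ler_addgt0Pr => e e0; rewrite add0r.
have D0 : 0 < `|C| + `|C'| + 1 by rewrite ltr_wpDl// addr_ge0.
have [t ht] := fbl_term_dense q (divr_gt0 e0 D0).
have St : S (fbl_term hp t) = S' (fbl_term hp t).
  rewrite !lattice_hom_fbl_term//; congr leval; apply/funext; exact: SS'.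
have -> : S q - S' q = S (q - fbl_term hp t) - S' (q - fbl_term hp t).
  by rewrite (raddfB S) (raddfB S') /= St opprB addrA subrK.
apply: le_trans (ler_normB _ _) _; apply: le_trans (lerD (hC _) (hC' _)) _.
rewrite -mulrDl; move: ht; set z := `|_|; rewrite ler_pdivlMr// => ht.
apply: le_trans ht; rewrite mulrC ler_wpM2l//; first exact: normr_ge0.
by apply: le_trans (lerD (ler_norm _) (ler_norm _)) _; rewrite lerDl.
Qed.

(** The graph of the extension is [{(t(delta), t(T))}], [t] a lattice expression; it
    is bounded by [leval_free_norm], and extends to the completion by density. *)
Lemma fbl_extension (T : {linear E -> X}) : p_convex p X -> (opnorm T < +oo)%E ->
  exists That : {linear F -> X},
    [/\ lattice_hom That, That \o fbl_delta hp =1 T,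
        (opnorm That <= (convexity_constant p X)%:E * opnorm T)%E
      & forall S : {linear F -> X}, lattice_hom S -> S \o fbl_delta hp =1 T -> S =1 That].
Proof.
move=> Xp /opnorm_fin[C0 [C00 TE TC]]; set M := convexity_constant p X.
have M1 : 1 <= M by exact: convexity_constant_ge1.
have M0 : 0 <= M by exact: le_trans M1.
pose xe t := leval (@Order.join _ X) T t.
pose near (e : R) (h g : F) := `|h - g| <= e.
pose G (q : F) (y : X) := exists2 t, q = fbl_term hp t & y = xe t.
have TL : linear T by move=> a u v; rewrite linearP.
have bnd t : `|xe t| <= M * C0 * `|fbl_term hp t|.
  by rewrite norm_fbl_term; apply: leval_free_norm => //; exact: convex_with_constant.
have [|e h g|e e' f g h|a e e' h g h' g'|e e' h g h' g'|
      a _ _ _ _ [t -> ->] [u -> ->]|_ _ _ _ [t -> ->] [u -> ->]|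
      e _ _ _ _ [t -> ->] [u -> ->]|Phi [PhiG Philin Phijoin]] :=
   @dense_extension R X F (@Order.join _ F) near G (M * C0).
- exact: mulr_ge0.
- by rewrite /near distrC.
- by rewrite /near => fg gh; apply: le_trans (ler_distD g _ _) (lerD _ _).
- rewrite /near => hg hg'; rewrite opprD addrACA -scalerBr.
  by apply: le_trans (ler_normD _ _) (lerD _ _) => //; rewrite normrZ ler_wpM2l.
- by rewrite /near => hg hg'; apply: le_trans (norm_joinB _ _ _ _) (lerD _ _).
- by exists (LAdd (LScale a t) u); rewrite ?fbl_term_lin.
- by exists (LJoin t u); rewrite ?fbl_term_join.
- rewrite /near => tu; have := bnd (LAdd t (LScale (-1) u)).
  rewrite fbl_termD fbl_termZ /xe /= !scaleN1r => /le_trans; apply.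
  by rewrite ler_wpM2l// mulr_ge0.
have ap q : approximable near G q.
  move=> e e0; have [t ht] := fbl_term_dense q e0.
  by exists (fbl_term hp t), (xe t); split=> //; exists t.
have Pl : linear Phi by move=> a u v; exact: Philin.
pose That : {linear F -> X} := HB.pack Phi (GRing.isLinear.Build R F X *:%R Phi Pl).
have Th : lattice_hom That by apply: lattice_hom_join => u v; exact: Phijoin.
have Tphi : That \o fbl_delta hp =1 T.
  move=> v; apply/eqP; rewrite -subr_eq0 -normr_le0 -[leRHS](mulr0 (M * C0)).
  apply: (PhiG _ (ap _) 0 (fbl_delta hp v)); first by exists (LVar v).
  by rewrite /near subrr normr0.
exists That; split=> //.
- rewrite TE -EFinM; apply: opnorm_le => [|q]; first exact: mulr_ge0.
  have xe0 : xe (LVar 0) = 0 by rewrite /xe /= linear0.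
  have := PhiG q (ap q) `|q| (fbl_term hp (LVar 0)) (xe (LVar 0)).
  rewrite xe0 fbl_term0 /near !subr0; apply; last exact: lexx.
  by exists (LVar 0); rewrite ?fbl_term0 ?xe0.
- move=> S Sh ST; apply: lattice_hom_fbl_eq => // v; by rewrite ST Tphi.
Qed.

End UniversalProperty.

(** * Essential uniqueness *)

Section EssentialUniqueness.
Context (R : realType) (p : \bar R) (E : completeNormedModType R).

Lemma free_contraction (F X : banachLatticeType R) (phi : {linear E -> F})
    (psi : {linear E -> X}) :
  is_free_banach_lattice p phi -> p_convex p X -> convexity_constant p X = 1 ->
  (forall v, `|psi v| = `|v|) ->
  exists U : {linear F -> X},
    [/\ lattice_hom U, U \o phi =1 psi & forall f, `|U f| <= `|f|].
Proof.
move=> [_ _ _ univ] Xp X1 psin.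
have psi1 : (opnorm psi <= 1%:E)%E.
  by apply: opnorm_le => // v; rewrite mul1r psin.
have [|U [Uh Uphi Un _]] := univ X psi Xp; first exact: le_lt_trans psi1 (ltry 1).
exists U; split=> // f; rewrite -[leRHS]mul1r.
by apply: opnorm_bound; apply: le_trans Un _; rewrite X1 mul1e.
Qed.

(** Both [W] and the identity extend the embedding. *)
Lemma free_hom_id (F : banachLatticeType R) (phi : {linear E -> F})
    (W : {linear F -> F}) :
  is_free_banach_lattice p phi -> lattice_hom W -> W \o phi =1 phi -> W =1 id.
Proof.
move=> [Fp _ phin univ] Wh Wphi.
have phi1 : (opnorm phi <= 1%:E)%E.
  by apply: opnorm_le => // v; rewrite mul1r phin.
have [|V [_ _ _ Vu]] := univ F phi Fp; first exact: le_lt_trans phi1 (ltry 1).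
have idV : (idfun : {linear F -> F}) =1 V by exact: Vu.
by move=> f; rewrite (Vu W)// -idV.
Qed.

(** The extensions of each embedding to the other lattice are contractions and, by
    uniqueness, inverse to each other. *)
Lemma free_banach_lattice_unique (F G : banachLatticeType R)
    (phi : {linear E -> F}) (psi : {linear E -> G}) :
  is_free_banach_lattice p phi -> is_free_banach_lattice p psi ->
  exists U : {linear F -> G},
    [/\ lattice_hom U, bijective U, forall f, `|U f| = `|f| & U \o phi =1 psi].
Proof.
move=> Ff Gf; have [Fp F1 phin _] := Ff; have [Gp G1 psin _] := Gf.
have [U [Uh Uphi Un]] := free_contraction Ff Gp G1 psin.
have [V [Vh Vpsi Vn]] := free_contraction Gf Fp F1 phin.
have comp_hom (A B C : banachLatticeType R) (f : {linear A -> B}) (g : {linear B -> C}) :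
    lattice_hom f -> lattice_hom g -> lattice_hom (g \o f).
  by move=> [fm fj] [gm gj]; split=> a b /=; rewrite ?fm ?fj ?gm ?gj.
have VU : V \o U =1 id.
  apply: (free_hom_id (W := V \o U) Ff); first exact: comp_hom.
  by move=> v; have := Uphi v; rewrite /= => ->; exact: Vpsi.
have UV : U \o V =1 id.
  apply: (free_hom_id (W := U \o V) Gf); first exact: comp_hom.
  by move=> v; have := Vpsi v; rewrite /= => ->; exact: Uphi.
exists U; split=> //; first by exists V.
by move=> f; apply/le_anti; rewrite Un/= -{1}[f]VU Vn.
Qed.

End EssentialUniqueness.

Theorem theorem1p1 (R : realType) (E : completeNormedModType R) (p : \bar R)
    (hp : (1 <= p)%E) :
  exists (F : banachLatticeType R) (phi : {linear E -> F}),
    is_free_banach_lattice p phi /\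
    forall (G : banachLatticeType R) (psi : {linear E -> G}),
      is_free_banach_lattice p psi ->
      exists U : {linear F -> G},
        [/\ lattice_hom U, bijective U, forall f, `|U f| = `|f|
          & U \o phi =1 psi].
Proof.
have free : is_free_banach_lattice p (fbl_delta hp : {linear E -> fbl E hp}).
  split; [exact: fbl_p_convex|exact: fbl_convexity_constant|exact: norm_fbl_delta|].
  by move=> X T Xp Tf; exact: fbl_extension.
exists (fbl E hp), (fbl_delta hp); split=> // G psi Gf.
exact: free_banach_lattice_unique free Gf.
Qed.
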